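(* Let $\mathcal{S}_1$ and $\mathcal{S}_2$ be two descriptional systems, with associated complexity measures $c_1$ and $c_2$. If both $\mathcal{S}_1$ and $\mathcal{S}_2$ are recursive, then there is a total function $f:\mathbb{N}\to\mathbb{N}$ that serves as an upper bound for the increase in complexity when changing from a descriptor in $\mathcal{S}_1$ to an equivalent descriptor in $\mathcal{S}_2$, satisfying $f\leq_T\emptyset''$. In case at least one descriptional system is not recursive (but recursively enumerable), the function $f:\mathbb{N}\to\mathbb{N}$ can be chosen to satisfy $f\leq_T\emptyset'''$.
   Context: A descriptional system $\mathcal{S}$ is a recursive set of non-empty finite descriptors, such that each descriptor $D\in\mathcal{S}$ describes a formal language $L(D)$, and if $L(D)$ is recursive (recursively enumerable), then there exists an effective procedure to convert $D$ into a Turing machine that decides (semi-decides) $L(D)$. The system is called recursive (recursively enumerable) if all the languages $L(D)$, $D\in\mathcal{S}$, are recursive (recursively enumerable); every descriptional system is taken to be at most recursively enumerable, i.e. all languages it describes are recursively enumerable. Put $\mathscr{L}(\mathcal{S})=\{L(D)\mid D\in\mathcal{S}\}$ and $\mathcal{S}(L)=\{D\in\mathcal{S}\mid L(D)=L\}$. A complexity measure for $\mathcal{S}$ is a total recursive function $c:\mathcal{S}\to\mathbb{N}$ such that for any alphabet $A$, the set of descriptors in $\mathcal{S}$ describing languages over $A$ is recursively enumerable in order of increasing size, and does not contain infinitely many descriptors of the same size. Whenever two systems are compared, $\mathscr{L}(\mathcal{S}_1)\cap\mathscr{L}(\mathcal{S}_2)$ is assumed to be non-empty. A total function $f:\mathbb{N}\to\mathbb{N}$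 with $f(n)\ge n$ is an upper bound for the increase in complexity when changing from a descriptor in $\mathcal{S}_1$ to an equivalent descriptor in $\mathcal{S}_2$ if for all $D_1\in\mathcal{S}_1$ with $L(D_1)\in\mathscr{L}(\mathcal{S}_2)$ there exists $D_2\in\mathcal{S}_2(L(D_1))$ such that $c_2(D_2)\le f(c_1(D_1))$. $\leq_T$ is Turing reducibility ($f\le_T B$ means that $f$ is computable by a Turing machine with oracle $B$), and $\emptyset'',\emptyset'''$ are the second and third jumps of $\emptyset$.
   Formalization: The bound is stated for descriptors of S1 over an arbitrary fixed alphabet A, and f may depend on A; with unboundedly many alphabets it fails (D_k describing {a_1...a_k}, c_1(D_k)=0, c_2(D_k)=k). *)

(* Defs.v *)
From HB Require Import structures.
From mathcomp Require Import all_boot.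
From mathcomp Require Import boolp classical_sets functions cardinality.

Set Implicit Arguments.
Unset Strict Implicit.
Unset Printing Implicit Defensive.

Local Open Scope classical_set_scope.

(** * Oracle Turing machines *)

Inductive move := Left | Stay | Right.

Definition nat_of_move (d : move) : nat :=
  match d with Left => 0 | Stay => 1 | Right => 2 end.
Definition move_of_nat (n : nat) : move :=
  match n with 0 => Left | 1 => Stay | _ => Right end.
Lemma nat_of_moveK : cancel nat_of_move move_of_nat.
Proof. by case. Qed.
HB.instance Definition _ := Countable.copy move (can_type nat_of_moveK).

(* States and tape symbols are natural numbers; the initial state is 0 and the
   blank symbol is 0.  The entry ((q, s, b), (q', s', d, d')) reads: in state q,
   with symbol s scanned on the work tape and bit b scanned on the read-only
   oracle tape, go to state q', overwrite s by s', move the work head by d and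
   the oracle head by d'. *)
Definition instr : Type := (nat * nat * bool) * (nat * nat * move * move).

(* A finite program.  If several entries apply, the first one is used. *)
Definition machine : Type := seq instr.

(* The two-way infinite work tape is (l, s, r): s is the scanned symbol, l and r
   are the contents to its left and right, nearest cell first, extended by
   blanks. *)
Definition tape : Type := seq nat * nat * seq nat.

Definition move_tape (d : move) (tp : tape) : tape :=
  let: (l, s, r) := tp in
  match d with
  | Left => (behead l, head 0 l, s :: r)
  | Stay => (l, s, r)
  | Right => (s :: l, head 0 r, behead r)
  end.

(* The oracle tape is one-way infinite; its head does not leave cell 0 to the
   left. *)
Definition move_pos (d : move) (i : nat) : nat :=
  match d with Left => i.-1 | Stay => i | Right => i.+1 end.

Record config := Config { cstate : nat; ctape : tape; cpos : nat }.

(* Cell i of the oracle tape carries the bit [i \in B].  [None] means that no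
   entry of the program applies, i.e. that the machine has halted. *)
Definition step (B : set nat) (M : machine) (c : config) : option config :=
  let: Config q (l, s, r) i := c in
  match [seq e.2 | e <- M & e.1 == (q, s, i \in B)] with
  | [::] => None
  | (q', s', d, d') :: _ =>
      Some (Config q' (move_tape d (l, s', r)) (move_pos d' i))
  end.

(* The number x is input as x consecutive symbols 1, the head scanning the
   leftmost one. *)
Definition init (x : nat) : config :=
  let w := nseq x 1 in Config 0 ([::], head 0 w, behead w) 0.

(* The output is the number of symbols 1 on the work tape. *)
Definition output (c : config) : nat :=
  let: (l, s, r) := ctape c in count_mem 1 (l ++ s :: r).

Definition computes (B : set nat) (M : machine) (x y : nat) : Prop :=
  exists t c, [/\ iter t (obind (step B M)) (Some (init x)) = Some c,
                  step B M c = None & output c = y].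

Definition halts (B : set nat) (M : machine) (x : nat) : Prop :=
  exists y, computes B M x y.

(** * Computability *)

(* Everything finite (words, programs) is represented by its Gödel number
   [pickle _].  The library defines [pickle] effectively: it is the identity
   on nat, the number of a sequence is [CodeSeq.code] of the numbers of its
   entries, i.e. cons is (n, m) |-> 2 ^ n * (2 * m + 1) and nil is 0, and pairs
   are numbered as sequences of length 2.  A Turing machine without oracle is an
   oracle machine run with the empty oracle. *)

Definition turing_le (f : nat -> nat) (B : set nat) : Prop :=
  exists M, forall x, computes B M x (f x).

Definition jump (B : set nat) : set nat :=
  [set e | exists M : machine, e = pickle M /\ halts B M e].

(** * Languages *)

(* Symbols are natural numbers. *)
Definition word : Type := seq nat.
Definition language : Type := set word.

(* A non-empty finite set of symbols, given by a list. *)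
Record alphabet := Alphabet { symbols : seq nat; _ : symbols != [::] }.

Definition decides (M : machine) (L : language) : Prop :=
  forall w : word, computes set0 M (pickle w) (w \in L).

Definition semidecides (M : machine) (L : language) : Prop :=
  forall w : word, halts set0 M (pickle w) <-> L w.

Definition recursive (L : language) : Prop := exists M, decides M L.
Definition rec_enumerable (L : language) : Prop := exists M, semidecides M L.

(** * Descriptional systems *)

(* Besides its language, a descriptor D carries an alphabet over which it
   describes it.  No effectivity is required of [alph]; it may in particular
   consist of just the symbols that occur in the language (if there are any). *)
Record system := System {
  descriptors :> set word;
  lang : word -> language;
  alph : word -> alphabet }.

Definition languages (S : system) : set language := lang S @` descriptors S.

Definition descriptors_of (S : system) (L : language) : set word :=
  [set D | descriptors S D /\ lang S D = L].

Definition descriptors_over (S : system) (A : alphabet) : set word :=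
  [set D | descriptors S D /\ {subset symbols (alph S D) <= symbols A}].

Definition recursive_system (S : system) : Prop :=
  forall D, descriptors S D -> recursive (lang S D).

Definition re_system (S : system) : Prop :=
  forall D, descriptors S D -> rec_enumerable (lang S D).

(* The conversion procedures are uniform in D.  The procedure yielding deciders
   is required only when the whole system is recursive: a uniform conversion of
   those descriptors that happen to describe a recursive language does not exist
   for, e.g., the system of all Turing machines. *)
Record descriptional_system (S : system) : Prop := {
  ds_recursive : recursive (descriptors S);
  ds_nonempty : forall D, descriptors S D -> D <> [::];
  ds_alph : forall D w, descriptors S D -> lang S D w -> {subset w <= symbols (alph S D)};
  ds_re : re_system S;
  ds_decide : recursive_system S ->
    exists P : machine, forall D, descriptors S D ->
      exists2 M : machine, computes set0 P (pickle D) (pickle M)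
                         & decides M (lang S D);
  ds_semidecide : re_system S ->
    exists P : machine, forall D, descriptors S D ->
      exists2 M : machine, computes set0 P (pickle D) (pickle M)
                         & semidecides M (lang S D) }.

(* X is the range of a total recursive sequence of words (or empty), along which
   c does not decrease. *)
Definition enumerable_in_order (c : word -> nat) (X : set word) : Prop :=
  X = set0 \/
  exists g : nat -> word,
    [/\ turing_le (fun i => pickle (g i)) set0,
        range g = X
      & forall i j, i <= j -> c (g i) <= c (g j)].

Record complexity_measure (S : system) (c : word -> nat) : Prop := {
  cm_recursive : exists M : machine, forall D, descriptors S D ->
    computes set0 M (pickle D) (c D);
  cm_enum : forall A : alphabet, enumerable_in_order c (descriptors_over S A);
  cm_finite : forall (A : alphabet) (n : nat),
    finite_set [set D | descriptors_over S A D /\ c D = n] }.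

(* The bound concerns descriptors over one arbitrary but fixed alphabet A, the
   setting in which a complexity measure admits only finitely many descriptors
   of each size.  With all (unboundedly large) alphabets at once there need not
   be any bound: take descriptors D_k of {a_1 ... a_k} over {a_1, ..., a_k} with
   c1 D_k = 0 and c2 D_k = k.  The equivalent descriptor D2 is not restricted to
   A. *)
Definition upper_bound (A : alphabet) (S1 S2 : system) (c1 c2 : word -> nat)
    (f : nat -> nat) : Prop :=
  (forall n, n <= f n) /\
  forall D1, descriptors_over S1 A D1 -> languages S2 (lang S1 D1) ->
    exists2 D2, descriptors_of S2 (lang S1 D1) D2 & c2 D2 <= f (c1 D1).

(* Main.v *)
Require Import Defs.
From mathcomp Require Import all_boot zify.
From mathcomp Require Import boolp classical_sets functions cardinality.

(* List the descriptors of S1 over A in order of increasing size.  Only finitely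
   many have size at most n, so it suffices to compute, for each descriptor D1 of
   the list, the size of some equivalent D2 of S2 if there is one.  If both
   systems are recursive, [lang S1 D1 = lang S2 D2] is a co-r.e. condition, hence
   decidable in the first jump of the empty set, and the existence of D2 is
   decidable in the second.  In general the semideciders make equivalence
   co-r.e. in the first jump, which costs one jump more.  If the list has bounded
   sizes then it is finite, and adding a constant to n is enough.

   Compiling while-programs to oracle machines shows that the functions computed
   by the latter are closed under recursion, minimization and oracle queries.  The
   code of a compiled search program depends computably on a hard-wired argument,
   so a condition that is r.e. in B is decidable in the jump of B.  A universal
   function runs the machines that come with the two systems. *)

Set Implicit Arguments.
Unset Strict Implicit.
Unset Printing Implicit Defensive.

Local Open Scope classical_set_scope.

(** * Compiling while-programs *)

Inductive cmd :=
  | Inc of nat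
  | Dec of nat
  | Seq of cmd & cmd
  | While of nat & cmd
  | Move of move
  | Query of nat.

(** The register contents, followed by the position of the head on the oracle tape. *)
Definition store : Type := (nat -> nat) * nat.

Definition upd (f : nat -> nat) (r v x : nat) : nat := if x == r then v else f x.

Inductive exec (B : set nat) : cmd -> store -> store -> Prop :=
  | ExInc r f p : exec B (Inc r) (f, p) (upd f r (f r).+1, p)
  | ExDec r f p : exec B (Dec r) (f, p) (upd f r (f r).-1, p)
  | ExSeq c1 c2 s1 s2 s3 :
      exec B c1 s1 s2 -> exec B c2 s2 s3 -> exec B (Seq c1 c2) s1 s3
  | ExStop r c f p : f r = 0 -> exec B (While r c) (f, p) (f, p)
  | ExLoop r c f p s2 s3 : f r <> 0 -> exec B c (f, p) s2 ->
      exec B (While r c) s2 s3 -> exec B (While r c) (f, p) s3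
  | ExMove d f p : exec B (Move d) (f, p) (f, move_pos d p)
  | ExQuery r f p : exec B (Query r) (f, p) (upd f r (f r + (p \in B)), p).

Definition action : Type := nat * nat * move * move.

Definition keys (N : nat) : seq (nat * bool) :=
  [seq (s, b) | s <- iota 0 N.+1, b <- [:: false; true]].

Definition row (N q : nat) (f : nat -> bool -> action) : machine :=
  [seq ((q, k.1, k.2), f k.1 k.2) | k <- keys N].

(** Rewinding: the head runs left to the first blank, then steps right onto the start of the word
    and enters [e]. *)
Definition home (q e s : nat) (b : bool) : action :=
  if s == 0 then (e, 0, Right, Stay) else (q, s, Left, Stay).

(** A rightward scan for [t] that branches: a found [t] becomes [t'] and control passes to [q1]; at
    the first blank [t0] is written and control passes to [q0]. *)
Definition search (q t q1 t' q0 t0 s : nat) (b : bool) : action :=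
  if s == 0 then (q0, t0, Left, Stay)
  else if s == t then (q1, t', Left, Stay) else (q, s, Right, Stay).

Fixpoint width (c : cmd) : nat :=
  match c with
  | Inc _ | Dec _ => 2
  | Seq c1 c2 => width c1 + width c2
  | While _ c => (width c).+3
  | Move _ => 1
  | Query _ => 3
  end.

(** With target 0 the blank test always comes first, so the scan reaches the end of the word and
    appends [r.+1] there. *)
Definition incr (N r q e : nat) : machine :=
  row N q (search q 0 0 0 q.+1 r.+1) ++ row N q.+1 (home q.+1 e).

(* The register r is the number of symbols r + 1 on the tape, and N is a symbol
   that stands for an erased one.  The program occupies the states from q to
   q + width c - 1 and leaves to e. *)
Fixpoint compile (N : nat) (c : cmd) (q e : nat) : machine :=
  match c with
  | Inc r => incr N r q e
  | Dec r =>
      row N q (search q r.+1 q.+1 N q.+1 0) ++ row N q.+1 (home q.+1 e)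
  | Seq c1 c2 =>
      compile N c1 q (q + width c1) ++ compile N c2 (q + width c1) e
  | While r c =>
      row N q (search q r.+1 q.+1 r.+1 q.+2 0) ++ row N q.+1 (home q.+1 q.+3) ++
      row N q.+2 (home q.+2 e) ++ compile N c q.+3 q
  | Move d => row N q (fun s _ => (e, s, Stay, d))
  | Query r =>
      row N q (fun s b => (if b then q.+1 else e, s, Stay, Stay)) ++
      incr N r q.+1 e
  end.

(** Makes the order of entries immaterial, so that a piece of program acts alike inside any
    deterministic program containing it. *)
Definition det (M : machine) : Prop :=
  forall k a a', (k, a) \in M -> (k, a') \in M -> a = a'.

Definition within (lo hi : nat) (M : machine) : Prop :=
  forall e, e \in M -> lo <= e.1.1.1 < hi.

Lemma mem_row N q f e : e \in row N q f ->
  exists s b, [/\ s <= N, e.1 = (q, s, b) & e.2 = f s b].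
Proof.
case/mapP => [[s b]] /allpairsP[[s' b'] [Hs _ [-> ->]]] ->.
by exists s', b'; split=> //; move: Hs; rewrite mem_iota add0n ltnS => /andP[].
Qed.

Lemma in_row N q f s b : s <= N -> ((q, s, b), f s b) \in row N q f.
Proof.
move=> Hs; apply/mapP; exists (s, b) => //.
by apply/allpairsP; exists (s, b); split=> //; [rewrite mem_iota add0n ltnS|case: b].
Qed.

Lemma within_row N q f lo hi : lo <= q < hi -> within lo hi (row N q f).
Proof. by move=> H e /mem_row[s [b [_ -> _]]]. Qed.

Lemma det_row N q f : det (row N q f).
Proof.
move=> k a a' /mem_row[s [b [_ /= -> ->]]] /mem_row[s' [b' [_ /=]]].
by move=> [-> ->] ->.
Qed.

Lemma rowE N q f :
  row N q f = [seq ((q, k.1, k.2), f k.1 k.2) | k <- keys N].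
Proof. by []. Qed.

Opaque row.

Lemma within_cat lo hi M1 M2 :
  within lo hi M1 -> within lo hi M2 -> within lo hi (M1 ++ M2).
Proof. by move=> H1 H2 e; rewrite mem_cat => /orP[/H1|/H2]. Qed.

Lemma within_sub lo hi lo' hi' M : lo' <= lo -> hi <= hi' ->
  within lo hi M -> within lo' hi' M.
Proof. by move=> H1 H2 H e /H; lia. Qed.

(** Entries of the two pieces start from different states, hence never share a key. *)
Lemma det_cat lo mid hi M1 M2 : within lo mid M1 -> within mid hi M2 ->
  det M1 -> det M2 -> det (M1 ++ M2).
Proof.
move=> H1 H2 D1 D2 k a a'; rewrite !mem_cat => /orP[K|K] /orP[K'|K'];
  [exact: D1 K K'| | |exact: D2 K K'].
  by move: (H1 _ K) (H2 _ K') => /=; lia.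
by move: (H2 _ K) (H1 _ K') => /=; lia.
Qed.

Lemma within_incr N r q e : within q q.+2 (incr N r q e).
Proof. by apply: within_cat; apply: within_row; lia. Qed.

Lemma det_incr N r q e : det (incr N r q e).
Proof.
apply: (@det_cat q q.+1 q.+2); try exact: det_row; apply: within_row; lia.
Qed.

Lemma within_compile N c q e : within q (q + width c) (compile N c q e).
Proof.
elim: c q e => [r|r|c1 IH1 c2 IH2|r c IH|d|r] q e /=.
- by apply: (within_sub _ _ (@within_incr _ _ _ _)); lia.
- by apply: within_cat; apply: within_row; lia.
- apply: within_cat; first by apply: (within_sub _ _ (IH1 _ _)); lia.
  by apply: (within_sub _ _ (IH2 _ _)); lia.
- do 3 (apply: within_cat; first by apply: within_row; lia).
  by apply: (within_sub _ _ (IH _ _)); lia.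
- by apply: within_row; lia.
- apply: within_cat; first by apply: within_row; lia.
  by apply: (within_sub _ _ (@within_incr _ _ _ _)); lia.
Qed.

Lemma det_compile N c q e : det (compile N c q e).
Proof.
elim: c q e => [r|r|c1 IH1 c2 IH2|r c IH|d|r] q e /=.
- exact: det_incr.
- by apply: (@det_cat q q.+1 q.+2); try exact: det_row; apply: within_row; lia.
- apply: (@det_cat q (q + width c1) (q + width c1 + width c2)) => //;
    exact: within_compile.
- have W := @within_compile N c q.+3 q.
  have W2 : within q.+2 (q.+3 + width c)
      (row N q.+2 (home q.+2 e) ++ compile N c q.+3 q).
    by apply: within_cat; [apply: within_row; lia|apply: (within_sub _ _ W); lia].
  have W1 : within q.+1 (q.+3 + width c)
      (row N q.+1 (home q.+1 q.+3) ++ row N q.+2 (home q.+2 e) ++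
       compile N c q.+3 q).
    by apply: within_cat; [apply: within_row; lia|apply: (within_sub _ _ W2); lia].
  apply: (@det_cat q _ _ _ _ _ W1); [by apply: within_row; lia|exact: det_row|].
  apply: (@det_cat q.+1 _ _ _ _ _ W2); [by apply: within_row; lia|exact: det_row|].
  by apply: (@det_cat q.+2 _ _ _ _ _ W); [by apply: within_row; lia|exact: det_row|].
- exact: det_row.
- apply: (@det_cat q _ _ _ _ _ (@within_incr _ _ _ _));
    [|exact: det_row|exact: det_incr].
  by apply: within_row; lia.
Qed.

Lemma step_det B M q s i b l r q' s' d d' : det M -> b = (i \in B) ->
  ((q, s, b), (q', s', d, d')) \in M ->
  step B M (Config q (l, s, r) i) =
    Some (Config q' (move_tape d (l, s', r)) (move_pos d' i)).
Proof.
move=> D -> H; rewrite /step.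
set L := [seq e.2 | e <- M & e.1 == (q, s, i \in B)].
have HL : (q', s', d, d') \in L.
  apply/mapP; exists ((q, s, i \in B), (q', s', d, d')) => //.
  by rewrite mem_filter eqxx.
have : forall a, a \in L -> a = (q', s', d, d').
  move=> a /mapP[[k a0]]; rewrite mem_filter /= => /andP[/eqP -> H0] ->.
  exact: D H0 H.
by case: L HL => // a L _ /(_ a); rewrite mem_head => -> .
Qed.

Lemma step_row B M N q f s i l r q' s' d d' : det M ->
    {subset row N q f <= M} -> s <= N -> f s (i \in B) = (q', s', d, d') ->
  step B M (Config q (l, s, r) i) =
    Some (Config q' (move_tape d (l, s', r)) (move_pos d' i)).
Proof.
by move=> D S sN E; apply: step_det D (erefl _) _; rewrite -E; apply/S/in_row.
Qed.

Lemma step_none B M q tp i :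
  (forall e, e \in M -> e.1.1.1 <> q) -> step B M (Config q tp i) = None.
Proof.
case: tp => [[l s] r] H; rewrite /step.
rewrite (_ : filter _ _ = [::]) //; apply/eqP; rewrite -[_ == _]negbK -has_filter.
apply/hasPn => -[[[q0 s0] b0] a] He; apply/eqP => -[E _ _].
exact: H He E.
Qed.

(** * Runs of machines, and the image of a store on the tape *)

Definition run (B : set nat) (M : machine) (t : nat) (c c' : config) : Prop :=
  iter t (obind (step B M)) (Some c) = Some c'.

Lemma run_trans B M t1 t2 c1 c2 c3 :
  run B M t1 c1 c2 -> run B M t2 c2 c3 -> run B M (t1 + t2) c1 c3.
Proof. by rewrite /run addnC iterD => ->. Qed.

Lemma run_cons B M t c1 c2 c3 :
  step B M c1 = Some c2 -> run B M t c2 c3 -> run B M t.+1 c1 c3.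
Proof. by move=> H; apply: (@run_trans _ _ 1); rewrite /run /= H. Qed.

(** Strong induction on [t]: each return of the invariant uses up at least one step. *)
Lemma run_forever B M (I : config -> Prop) :
  (forall c, I c -> exists t c', run B M t.+1 c c' /\ I c') ->
  forall t c, I c -> iter t (obind (step B M)) (Some c) <> None.
Proof.
move=> H t; elim/ltn_ind: t => t IH c /H[u [c' [R Ic]]].
have [lt|le] := ltnP u t.
  have -> : t = (t - u.+1) + u.+1 by lia.
  by rewrite iterD R; apply: IH => //; lia.
(* Here [t] is at most [u], and a run that is over by time [t] cannot be alive at time [u.+1]. *)
move=> E; move: R; rewrite /run.
have -> : u.+1 = (u.+1 - t) + t by lia.
rewrite iterD E (_ : iter _ _ None = None) //; by elim: (_ - _) => //= n ->.
Qed.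

Definition zipper (l y : seq nat) : tape := (l, head 0 y, behead y).

Definition blank (y : seq nat) : bool := all (pred1 0) y.

Lemma blank_head y : blank y -> head 0 y = 0.
Proof. by case: y => //= a y /andP[/eqP]. Qed.

Lemma blank_behead y : blank y -> blank (behead y).
Proof. by case: y => //= a y /andP[]. Qed.

(* u lists the non-blank symbols to the left of the head, nearest first. *)
Lemma run_home B M N q e u z s r i : det M ->
    {subset row N q (home q e) <= M} -> all (fun a => 0 < a <= N) u -> blank z ->
  exists t z', blank z' /\
    run B M t.+1 (Config q (move_tape Left (u ++ z, s, r)) i)
                 (Config e (zipper z' (catrev u (s :: r))) i).
Proof.
move=> D S; elim: u s r => [|a u IH] s r /=.
  move=> _ bz; exists 0, (0 :: behead z); split; first exact: blank_behead.
  rewrite blank_head //; apply: (run_cons _ (erefl _ : run _ _ 0 _ _)).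
  by rewrite (step_row _ _ D S (leq0n N) (erefl _)).
move=> /andP[Ha Hu] bz; have [t [z' [bz' R]]] := IH a (s :: r) Hu bz.
exists t.+1, z'; split=> //; apply: (run_cons _ R).
have aN : a <= N by lia.
rewrite (step_row _ _ D S aN (_ : _ = (q, a, Left, Stay))) // /home.
by case: eqP => //; lia.
Qed.

Lemma run_search B M N q t q1 t' q0 t0 u l y i : det M ->
    {subset row N q (search q t q1 t' q0 t0) <= M} ->
    all (fun a => 0 < a <= N) u -> t \notin u ->
  exists k, run B M k (Config q (zipper l (u ++ y)) i)
                      (Config q (zipper (catrev u l) y) i).
Proof.
move=> D S; elim: u l => [|a u IH] l /=; first by exists 0.
move=> /andP[Ha Hu]; rewrite inE => /norP[ta /(IH (a :: l) Hu)[k R]].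
exists k.+1; apply: (run_cons _ R); have aN : a <= N by lia.
rewrite (step_row _ _ D S aN (_ : _ = (q, a, Right, Stay))) // /search.
by rewrite [a == t]eq_sym (negPf ta); case: eqP => //; lia.
Qed.

(** The head stands on the first cell of [w], with blanks on both sides. Only multiplicities of
    symbols below [N] matter, so the order of [w] and the number of marks [N] are free. *)
Definition rep (N : nat) (st : store) (q : nat) (c : config) : Prop :=
  exists z w z', [/\ c = Config q (zipper z (w ++ z')) st.2, blank z, blank z',
    all (fun a => 0 < a <= N) w
    & forall r, r.+1 < N -> count_mem r.+1 w = st.1 r].

Lemma run_search_blank B M N q t q1 t' q0 t0 e w z z' i : det M ->
    {subset row N q (search q t q1 t' q0 t0) <= M} ->
    {subset row N q0 (home q0 e) <= M} ->
    all (fun a => 0 < a <= N) w -> t \notin w -> blank z -> blank z' ->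
  exists k z1, blank z1 /\
    run B M k.+1 (Config q (zipper z (w ++ z')) i)
                 (Config e (zipper z1 (w ++ t0 :: behead z')) i).
Proof.
move=> D S H aw tw bz bz'; have [k R] := run_search B z z' i D S aw tw.
have aw' : all (fun a => 0 < a <= N) (rev w) by rewrite all_rev.
have [k' [z1 [bz1 R']]] := run_home B t0 (behead z') i D H aw' bz.
exists (k + k'.+1), z1; split=> //; rewrite -addnS; apply: run_trans R _.
rewrite (_ : w ++ _ = catrev (rev w) (t0 :: behead z')); last first.
  by rewrite catrevE revK.
apply: (run_cons _ R'); rewrite catrevE /zipper blank_head //.
by rewrite (step_row _ _ D S (leq0n N) (erefl _)).
Qed.

Lemma run_search_found B M N q t q1 t' q0 t0 e w1 w2 z i : det M ->
    {subset row N q (search q t q1 t' q0 t0) <= M} ->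
    {subset row N q1 (home q1 e) <= M} -> 0 < t <= N ->
    all (fun a => 0 < a <= N) w1 -> t \notin w1 -> blank z ->
  exists k z1, blank z1 /\
    run B M k.+1 (Config q (zipper z (w1 ++ t :: w2)) i)
                 (Config e (zipper z1 (w1 ++ t' :: w2)) i).
Proof.
move=> D S H tN aw tw bz; have [k R] := run_search B z (t :: w2) i D S aw tw.
have aw' : all (fun a => 0 < a <= N) (rev w1) by rewrite all_rev.
have [k' [z1 [bz1 R']]] := run_home B t' w2 i D H aw' bz.
exists (k + k'.+1), z1; split=> //; rewrite -addnS; apply: run_trans R _.
rewrite (_ : w1 ++ _ = catrev (rev w1) (t' :: w2)); last first.
  by rewrite catrevE revK.
apply: (run_cons _ R').
have tN' : t <= N by lia.
rewrite catrevE (step_row _ _ D S tN' (_ : _ = (q1, t', Left, Stay))) //.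
rewrite /search eqxx.
by case: eqP => //; lia.
Qed.

Fixpoint bounded (N : nat) (c : cmd) : bool :=
  match c with
  | Inc r | Dec r | Query r => r.+1 < N
  | Seq c1 c2 => bounded N c1 && bounded N c2
  | While r c => (r.+1 < N) && bounded N c
  | Move _ => true
  end.

Lemma bounded_le N N' c : N <= N' -> bounded N c -> bounded N' c.
Proof.
move=> le; elim: c => //= [r|r|c1 IH1 c2 IH2|r c IH|r]; lia.
Qed.

Lemma boundedP c : exists N, bounded N c.
Proof.
elim: c => [r|r|c1 [N1 H1] c2 [N2 H2]|r c [N H]|d|r] /=; try by exists r.+2.
- by exists (maxn N1 N2); rewrite (bounded_le _ H1) ?(bounded_le _ H2) //; lia.
- exists (maxn N r.+2); rewrite (bounded_le _ H) ?andbT; lia.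
- by exists 0.
Qed.

Lemma cat_subl (M1 M2 M : machine) :
  {subset M1 ++ M2 <= M} -> {subset M1 <= M}.
Proof. by move=> H e He; apply: H; rewrite mem_cat He. Qed.

Lemma cat_subr (M1 M2 M : machine) :
  {subset M1 ++ M2 <= M} -> {subset M2 <= M}.
Proof. by move=> H e He; apply: H; rewrite mem_cat He orbT. Qed.

Lemma run_incr B M N r q e c f p : det M -> {subset incr N r q e <= M} ->
    r.+1 < N -> rep N (f, p) q c ->
  exists t c', run B M t.+1 c c' /\ rep N (upd f r (f r).+1, p) e c'.
Proof.
move=> D S rN [z [w [z' [-> /= bz bz' aw cw]]]].
have w0 : 0 \notin w by apply/negP => /(allP aw).
have [k [z1 [bz1 R]]] := run_search_blank B p D
  (cat_subl S) (cat_subr S) aw w0 bz bz'.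
exists k, (Config e (zipper z1 ((w ++ [:: r.+1]) ++ behead z')) p); split.
  by rewrite -catA.
exists z1, (w ++ [:: r.+1]), (behead z'); split=> //=; first exact: blank_behead.
  by rewrite all_cat aw /=; lia.
move=> r' r'N; rewrite count_cat cw //= /upd eqSS addn0.
by rewrite eq_sym; case: eqP => [->|_]; lia.
Qed.

Lemma split_first (t : nat) w : t \in w ->
  exists w1 w2, w = w1 ++ t :: w2 /\ t \notin w1.
Proof.
move=> tw; exists (take (index t w) w), (drop (index t w).+1 w); split.
  by rewrite -{2}(nth_index 0 tw) -drop_nth ?index_mem // cat_take_drop.
by rewrite in_take_leq ?index_size // ltnn.
Qed.

(** The found symbol is rewritten by itself, so the store is kept. The number of steps is recorded
    as positive for the later proof of divergence. *)
Lemma run_test B M N r c q e f p k : det M ->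
    {subset compile N (While r c) q e <= M} -> r.+1 < N -> f r <> 0 ->
    rep N (f, p) q k ->
  exists t k', run B M t.+1 k k' /\ rep N (f, p) q.+3 k'.
Proof.
move=> D S rN f0 [z [w [z' [-> /= bz bz' aw cw]]]].
have rw : r.+1 \in w.
  by apply: contraT => /count_memPn; rewrite cw.
have [w1 [w2 [Ew rw1]]] := split_first rw.
move: (aw); rewrite {1}Ew all_cat /= => /and3P[aw1 Hr aw2].
have [t [z1 [bz1 R]]] := run_search_found B (w2 ++ z') p D
  (cat_subl S) (cat_subl (cat_subr S)) Hr aw1 rw1 bz.
exists t; eexists; split; first by rewrite Ew -catA; exact: R.
by exists z1, w, z'; split=> //=; rewrite Ew -catA.
Qed.

Lemma run_exec B M N c st st' : exec B c st st' -> bounded N c -> det M ->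
  forall q e k, {subset compile N c q e <= M} -> rep N st q k ->
  exists t k', run B M t k k' /\ rep N st' e k'.
Proof.
elim=> {c st st'}
  [r f p|r f p|c1 c2 s1 s2 s3 _ IH1 _ IH2|r c f p f0|
   r c f p s2 s3 f0 _ IH1 _ IH2|d f p|r f p] /=.
- move=> rN D q e k S /(@run_incr B _ _ _ _ _ _ _ _ D S rN)[t [k' [R H]]].
  by exists t.+1, k'.
- move=> rN D q e k S [z [w [z' [-> /= bz bz' aw cw]]]].
  have [rw|rw] := boolP (r.+1 \in w); last first.
    have [t [z1 [bz1 R]]] := run_search_blank B p D
      (cat_subl S) (cat_subr S) aw rw bz bz'.
    exists t.+1; eexists; split; first exact: R.
    (* No [r.+1] is present, so the register is 0 and equals its predecessor; the blank is merely
       rewritten. *)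
    exists z1, w, (0 :: behead z'); split=> //=; first exact: blank_behead.
    move=> r' r'N; rewrite cw // /upd; case: eqP => // ->.
    by rewrite -cw // (count_memPn rw).
  have [w1 [w2 [Ew rw1]]] := split_first rw.
  move: aw cw; rewrite Ew all_cat /= => /and3P[aw1 Hr aw2] cw.
  have [t [z1 [bz1 R]]] := run_search_found B (w2 ++ z') p D
    (cat_subl S) (cat_subr S) Hr aw1 rw1 bz.
  exists t.+1; eexists; split; first by rewrite -catA; exact: R.
  (* The erased occurrence leaves the mark [N]: being non-blank it makes no gap in the word, and it
     lies above all symbols that registers count. *)
  exists z1, (w1 ++ N :: w2), z'; split=> //=; first by rewrite -catA.
    by rewrite all_cat aw1 /= aw2 andbT; lia.
  move=> r' r'N; have := cw r' r'N; rewrite !count_cat /= /upd eqSS.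
  case: (N =P r'.+1) => [|_]; first lia.
  by rewrite [r == r']eq_sym; case: eqP => [->|_]; lia.
- move=> /andP[B1 B2] D q e k S /(IH1 B1 D _ _ _ (cat_subl S))[t [k' [R]]].
  move=> /(IH2 B2 D _ _ _ (cat_subr S))[t' [k2 [R' H]]].
  by exists (t + t'), k2; split=> //; apply: run_trans R R'.
- move=> /andP[rN Bc] D q e k S [z [w [z' [-> /= bz bz' aw cw]]]].
  have rw : r.+1 \notin w by apply/count_memPn; rewrite cw.
  have [t [z1 [bz1 R]]] := run_search_blank B p D (cat_subl S)
    (cat_subl (cat_subr (cat_subr S))) aw rw bz bz'.
  exists t.+1; eexists; split; first exact: R.
  by exists z1, w, (0 :: behead z'); split=> //=; exact: blank_behead.
- move=> /andP[rN Bc] D q e k S.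
  move=> /(@run_test B _ _ _ _ _ _ _ _ _ D S rN f0)[t [k1 [R1]]].
  move=> /(IH1 Bc D _ _ _ (cat_subr (cat_subr (cat_subr S)))).
  move=> [t2 [k2 [R2]]]; have BW : bounded N (While r c) by rewrite /= rN.
  move=> /(IH2 BW D q e _ S)[t3 [k3 [R3 H]]].
  exists (t.+1 + (t2 + t3)), k3; split=> //.
  exact: run_trans R1 (run_trans R2 R3).
- move=> _ D q e k S [z [w [z' [-> /= bz bz' aw cw]]]].
  exists 1; eexists; split.
    apply: (run_cons _ (erefl _ : run _ _ 0 _ _)).
    apply: (step_row _ _ D S _ (erefl _)).
    case: w aw {cw} => [|a w] /=; [by rewrite blank_head|by lia].
  by exists z, w, z'.
- move=> rN D q e k S Hk; have [z [w [z' [Ek /= bz bz' aw cw]]]] := Hk.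
  have hN : head 0 (w ++ z') <= N.
    by case: w aw {cw Ek} => [|a w] /=; [rewrite blank_head|lia].
  have H := step_row z (behead (w ++ z')) D (cat_subl S) hN
    (erefl (if p \in B then _ else _, _, _, _)).
  case: (boolP (p \in B)) H => pB H; last first.
    exists 1; eexists; split.
      by rewrite Ek; apply: (run_cons H (erefl _ : run _ _ 0 _ _)).
    exists z, w, z'; split=> //= r' r'N; rewrite cw // /upd addn0.
    by case: eqP => [->|].
  have H1 : rep N (f, p) q.+1 (Config q.+1 (zipper z (w ++ z')) p).
    by exists z, w, z'.
  have [t [k' [R Hk']]] := @run_incr B _ _ _ _ _ _ _ _ D (cat_subr S) rN H1.
  exists t.+2, k'; split; first by rewrite Ek; apply: run_cons H R.
  by rewrite addn1.
Qed.

(** * Functions computed by while-programs *)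

Ltac upd_tac :=
  rewrite /upd; repeat (case: eqP => ?); subst; try done; try congruence; try lia.

Definition clear (r : nat) : cmd := While r (Dec r).

Lemma exec_clear B r f p : exec B (clear r) (f, p) (upd f r 0, p).
Proof.
have [n le] : exists n, f r <= n by exists (f r).
elim: n f le => [|n IH] f le.
  have -> : upd f r 0 = f by apply/funext => x; upd_tac.
  by apply: ExStop; lia.
have [/eqP f0|/eqP f0] := boolP (f r == 0).
  by rewrite (_ : upd f r 0 = f); [exact: ExStop|apply/funext => x; upd_tac].
apply: (ExLoop f0 (ExDec _ _ _ _)).
rewrite (_ : upd f r 0 = upd (upd f r (f r).-1) r 0).
  by apply: IH; rewrite /upd eqxx; lia.
by apply/funext => x; upd_tac.
Qed.

Definition pour (r t : nat) : cmd := While r (Seq (Dec r) (Inc t)).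

Lemma exec_pour B r t f p : r <> t ->
  exec B (pour r t) (f, p) (upd (upd f t (f t + f r)) r 0, p).
Proof.
move=> rt; have [n le] : exists n, f r <= n by exists (f r).
elim: n f le => [|n IH] f le.
  by rewrite (_ : upd _ r 0 = f); [apply: ExStop; lia|apply/funext => x; upd_tac].
have [/eqP f0|/eqP f0] := boolP (f r == 0).
  by rewrite (_ : upd _ r 0 = f); [exact: ExStop|apply/funext => x; upd_tac].
apply: (ExLoop f0 (ExSeq (ExDec _ _ _ _) (ExInc _ _ _ _))).
set g := upd _ t _.
rewrite (_ : upd _ r 0 = upd (upd g t (g t + g r)) r 0).
  by apply: IH; rewrite /g; upd_tac.
by apply/funext => x; rewrite /g; upd_tac.
Qed.

Definition split (r t u : nat) : cmd :=
  While r (Seq (Dec r) (Seq (Inc t) (Inc u))).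

Lemma exec_split B r t u f p : r <> t -> r <> u -> t <> u ->
  exec B (split r t u) (f, p)
    (upd (upd (upd f t (f t + f r)) u (f u + f r)) r 0, p).
Proof.
move=> rt ru tu; have [n le] : exists n, f r <= n by exists (f r).
elim: n f le => [|n IH] f le.
  by rewrite (_ : upd _ r 0 = f); [apply: ExStop; lia|apply/funext => x; upd_tac].
have [/eqP f0|/eqP f0] := boolP (f r == 0).
  by rewrite (_ : upd _ r 0 = f); [exact: ExStop|apply/funext => x; upd_tac].
apply: (ExLoop f0 (ExSeq (ExDec _ _ _ _) (ExSeq (ExInc _ _ _ _) (ExInc _ _ _ _)))).
set g := upd _ u _.
rewrite (_ : upd _ r 0 = upd (upd (upd g t (g t + g r)) u (g u + g r)) r 0).
  by apply: IH; rewrite /g; upd_tac.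
by apply/funext => x; rewrite /g; upd_tac.
Qed.

(** Reading a register empties it, so a second copy is kept in [u] and poured back. *)
Definition copy (r t u : nat) : cmd :=
  Seq (clear t) (Seq (clear u) (Seq (split r t u) (pour u r))).

Lemma exec_copy B r t u f p : r <> t -> r <> u -> t <> u ->
  exec B (copy r t u) (f, p) (upd (upd f t (f r)) u 0, p).
Proof.
move=> rt ru tu; apply: ExSeq (exec_clear _ _ _ _) _.
apply: ExSeq (exec_clear _ _ _ _) _; apply: ExSeq (exec_split _ _ _ rt ru tu) _.
set g := upd _ r 0.
rewrite (_ : upd (upd f t _) u 0 = upd (upd g r (g r + g u)) u 0).
  by apply: exec_pour; lia.
by apply/funext => x; rewrite /g; upd_tac.
Qed.

Definition shift (r : nat) (d : move) : cmd := While r (Seq (Dec r) (Move d)).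

Lemma exec_shift B r d f p :
  exec B (shift r d) (f, p) (upd f r 0, iter (f r) (move_pos d) p).
Proof.
have [n le] : exists n, f r <= n by exists (f r).
elim: n f p le => [|n IH] f p le.
  rewrite (_ : f r = 0) /=; last lia.
  by rewrite (_ : upd _ r 0 = f); [apply: ExStop; lia|apply/funext => x; upd_tac].
case f0: (f r) => [|m] /=.
  by rewrite (_ : upd _ r 0 = f); [exact: ExStop|apply/funext => x; upd_tac].
have f1 : f r <> 0 by lia.
apply: (ExLoop f1 (ExSeq (ExDec _ _ _ _) (ExMove _ _ _ _))).
set g := upd _ r _.
have gm : g r = m by rewrite /g; upd_tac.
rewrite (_ : upd _ r 0 = upd g r 0) -?iterS ?iterSr.
  by rewrite -gm; apply: IH; lia.
by apply/funext => x; rewrite /g; upd_tac.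
Qed.

(** Extends an environment by a new de Bruijn variable 0; it serves for values and for register
    assignments alike. *)
Definition scons (x : nat) (s : nat -> nat) (i : nat) : nat :=
  if i is j.+1 then s j else x.

(* The program c computes f from the registers rg 0, rg 1, ... into the register
   b, all of the registers from b on serving as scratch space. *)
Definition implements (B : set nat) (c : cmd) (f : (nat -> nat) -> nat)
    (rg : nat -> nat) (b : nat) : Prop :=
  forall s, exists s', [/\ exec B c (s, 0) (s', 0),
    s' b = f (fun i => s (rg i)) & forall r, r < b -> s' r = s r].

(* f is a function of the values s 0, s 1, ... of de Bruijn variables. *)
Definition computable (B : set nat) (f : (nat -> nat) -> nat) : Prop :=
  forall rg b, (forall i, rg i < b) -> exists c, implements B c f rg b.

Lemma comp_ext B f g : f =1 g -> computable B f -> computable B g.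
Proof. by move/funext => ->. Qed.

Lemma comp_var B i : computable B (fun s => s i).
Proof.
move=> rg b ib; exists (copy (rg i) b b.+1) => s; have := ib i => ibi.
exists (upd (upd s b (s (rg i))) b.+1 0); split.
- by apply: exec_copy; lia.
- by upd_tac.
- by move=> r rb; upd_tac.
Qed.

Lemma comp_zero B : computable B (fun=> 0).
Proof.
move=> rg b ib; exists (clear b) => s; exists (upd s b 0); split.
- exact: exec_clear.
- by upd_tac.
- by move=> r rb; upd_tac.
Qed.

Lemma comp_succ B a : computable B a -> computable B (fun s => (a s).+1).
Proof.
move=> Ca rg b ib; have [c Hc] := Ca rg b ib; exists (Seq c (Inc b)) => s.
have [s' [E V P]] := Hc s; exists (upd s' b (s' b).+1); split.
- exact: ExSeq E (ExInc _ _ _ _).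
- by rewrite -V; upd_tac.
- by move=> r rb; rewrite -P //; upd_tac.
Qed.

Lemma comp_const B n : computable B (fun=> n).
Proof. by elim: n => [|n IH]; [exact: comp_zero|exact: comp_succ]. Qed.

(** Renaming only changes the register assignment, over which [computable] quantifies. *)
Lemma comp_ren B f rho :
  computable B f -> computable B (fun s => f (fun i => s (rho i))).
Proof. by move=> Cf rg b ib; apply: (Cf (fun i => rg (rho i))). Qed.

Lemma scons_lt rg b r : (forall i, rg i < b) -> r < b.+1 ->
  forall i, scons r rg i < b.+1.
Proof. by move=> ib rb [|i] //=; have := ib i; lia. Qed.

Lemma comp_scons s rg r :
  (fun i => s (scons r rg i)) = scons (s r) (fun i => s (rg i)).
Proof. by apply/funext => -[]. Qed.

Lemma comp_let B f a : computable B a -> computable B f ->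
  computable B (fun s => f (scons (a s) s)).
Proof.
move=> Ca Cf rg b ib; have [ca Ha] := Ca rg b ib.
have [cf Hf] := Cf (scons b rg) b.+1 (scons_lt ib (ltnSn b)).
(* The value of [a] stays in [b] as variable 0 while [f] works from [b.+1] on; afterwards its result
   is moved down into [b]. *)
exists (Seq ca (Seq cf (Seq (clear b) (pour b.+1 b)))) => s.
have [s1 [E1 V1 P1]] := Ha s; have [s2 [E2 V2 P2]] := Hf s1.
eexists; split.
- apply: ExSeq E1 _; apply: ExSeq E2 _; apply: ExSeq (exec_clear _ _ _ _) _.
  by apply: exec_pour; lia.
- rewrite /upd !eqxx; case: eqP => [|_]; first lia.
  case: eqP => [|_]; first lia.
  rewrite add0n V2 comp_scons V1; congr (f (scons _ _)).
  by apply/funext => i; rewrite P1.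
- by move=> r rb; rewrite -P1 // -P2 //; [upd_tac|lia].
Qed.

Lemma comp_rec B a n g : computable B a -> computable B n ->
    computable B (fun s => g (s 0) (s 1) (fun i => s i.+2)) ->
  computable B (fun s => nat_rec (fun=> nat) (a s) (fun k r => g k r s) (n s)).
Proof.
move=> Ca Cn Cg rg b ib; have [ca Ha] := Ca rg b ib.
have ib1 : forall i, rg i < b.+1 by move=> i; have := ib i; lia.
have [cn Hn] := Cn rg b.+1 ib1.
have ib3 : forall i, scons b.+2 (scons b rg) i < b.+3.
  by move=> [|[|i]] //=; [lia|have := ib i; lia].
have [cg Hg] := Cg _ _ ib3.
(* Register [b] holds the accumulator, [b.+1] the rounds left, [b.+2] the counter [k], and [b.+3]
   the new value delivered by [g]. *)
pose body := Seq (Dec b.+1) (Seq cg (Seq (clear b) (Seq (pour b.+3 b) (Inc b.+2)))).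
have loop s0 : forall m k s, s b.+1 = m -> s b.+2 = k ->
    s b = nat_rec (fun=> nat) (a s0) (fun k r => g k r s0) k ->
    s0 = (fun i => s (rg i)) ->
  exists s', [/\ exec B (While b.+1 body) (s, 0) (s', 0),
    s' b = nat_rec (fun=> nat) (a s0) (fun k r => g k r s0) (k + m)
    & forall r, r < b -> s' r = s r].
  elim=> [|m IH] k s Hm Hk Hb Hs.
    by exists s; split; [exact: ExStop|rewrite addn0|].
  have [s1 [E1 V1 P1]] := Hg (upd s b.+1 m).
  set s2 := upd (upd s1 b (s1 b.+3)) b.+3 0.
  have [||||s' [E V P]] := IH k.+1 (upd s2 b.+2 (s2 b.+2).+1).
  - by rewrite /s2; upd_tac; rewrite P1 //; upd_tac.
  - rewrite /s2; upd_tac; rewrite P1 //; upd_tac.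
  - transitivity (s1 b.+3); first by rewrite /s2; upd_tac.
    rewrite V1 /=; congr g.
    + by upd_tac.
    + by rewrite -Hb; upd_tac.
    + by rewrite Hs; apply/funext => i; have := ib i; upd_tac.
  - rewrite Hs; apply/funext => i; have := ib i => ?.
    have -> : upd s2 b.+2 (s2 b.+2).+1 (rg i) = s1 (rg i) by rewrite /s2; upd_tac.
    by rewrite P1 //; [upd_tac|lia].
  exists s'; split; [|by rewrite V addSnnS|].
  - have s0' : s b.+1 <> 0 by lia.
    apply: (ExLoop s0' _ E); apply: ExSeq (ExDec _ _ _ _) _.
    rewrite Hm /=; apply: ExSeq E1 _; apply: ExSeq (exec_clear _ _ _ _) _.
    apply: ExSeq (exec_pour _ _ _ _) _; first by lia.
    rewrite (_ : upd (upd (upd s1 b 0) b _) b.+3 0 = s2); first exact: ExInc.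
    by apply/funext => x; rewrite /s2; upd_tac.
  - move=> r rb; rewrite P //.
    have -> : upd s2 b.+2 (s2 b.+2).+1 r = s1 r by rewrite /s2; upd_tac.
    by rewrite P1 //; [upd_tac|lia].
exists (Seq ca (Seq cn (Seq (clear b.+2) (While b.+1 body)))) => s.
have [s1 [E1 V1 P1]] := Ha s; have [s2 [E2 V2 P2]] := Hn s1.
have Es : (fun i => s (rg i)) = (fun i => s1 (rg i)).
  by apply/funext => i; rewrite P1.
have [||||s' [E V P]] :=
  loop (fun i => s (rg i)) (n (fun i => s (rg i))) 0 (upd s2 b.+2 0).
- by rewrite Es -V2; upd_tac.
- by upd_tac.
- by rewrite /= -V1 -P2 //; upd_tac.
- by apply/funext => i; have := ib i => ?; rewrite -P1 // -P2; [upd_tac|lia].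
exists s'; split=> //.
- by apply: ExSeq E1 _; apply: ExSeq E2 _; apply: ExSeq (exec_clear _ _ _ _) E.
- by move=> r rb; rewrite P // -P1 // -P2; [upd_tac|lia].
Qed.

(** Candidates are tried in register [b], with the test value in [b.+1]; the induction is on the
    distance to the least zero [m]. The same loop reappears in the jump argument, where a zero may
    fail to exist. *)
Lemma exec_search B F rg b cF m s : (forall i, rg i < b) ->
    implements B cF (fun s => F (s 0) (fun i => s i.+1)) (scons b rg) b.+1 ->
    F m (fun i => s (rg i)) = 0 ->
    (forall k, k < m -> F k (fun i => s (rg i)) <> 0) -> s b = 0 ->
  exists s', [/\ exec B (Seq cF (While b.+1 (Seq (Inc b) cF))) (s, 0) (s', 0),
    s' b = m & forall r, r < b -> s' r = s r].
Proof.
move=> ib HF Fm Fk sb; set s0 := fun i => s (rg i) in Fm Fk.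
have loop : forall d k t, k + d = m -> t b = k -> t b.+1 = F k s0 ->
    (forall r, r < b -> t r = s r) ->
  exists s', [/\ exec B (While b.+1 (Seq (Inc b) cF)) (t, 0) (s', 0),
    s' b = m & forall r, r < b -> s' r = s r].
  elim=> [|d IH] k t Ek Hk H1 Hr.
    exists t; split=> //; last by lia.
    by apply: ExStop; rewrite H1 -Fm; congr F; lia.
  have [t1 [E1 V1 P1]] := HF (upd t b (t b).+1).
  have [||||s' [E V P]] := IH k.+1 t1.
  - by lia.
  - by rewrite P1; [upd_tac|lia].
  - rewrite V1 /=; congr F; first by upd_tac.
    by apply/funext => i; have := ib i => ?; rewrite /s0 -Hr //; upd_tac.
  - by move=> r rb; rewrite P1 -?Hr //; [upd_tac|lia].
  exists s'; split=> //; apply: ExLoop E; last exact: ExSeq (ExInc _ _ _ _) E1.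
  by rewrite H1; apply: Fk; lia.
have [t [E V P]] := HF s.
have [||||s' [E' V' P']] := loop m 0 t.
- by [].
- by rewrite P.
- by rewrite V /= sb.
- by move=> r rb; rewrite P //; lia.
- by exists s'; split=> //; apply: ExSeq E E'.
Qed.

Lemma comp_mu B F h : computable B (fun s => F (s 0) (fun i => s i.+1)) ->
    (forall s, F (h s) s = 0) -> (forall s k, k < h s -> F k s <> 0) ->
  computable B h.
Proof.
move=> CF Fh Fk rg b ib; have [cF HF] := CF _ _ (scons_lt ib (ltnSn b)).
exists (Seq (clear b) (Seq cF (While b.+1 (Seq (Inc b) cF)))) => s.
have Es : (fun i => upd s b 0 (rg i)) = (fun i => s (rg i)).
  by apply/funext => i; have := ib i; upd_tac.
have [|||s' [E V P]] :=
  exec_search (m := h (fun i => s (rg i))) (s := upd s b 0) ib HF.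
- by rewrite Es.
- by move=> k; rewrite Es; apply: Fk.
- by upd_tac.
exists s'; split=> //; first by apply: ExSeq (exec_clear _ _ _ _) E.
by move=> r rb; rewrite P //; upd_tac.
Qed.

Lemma comp_oracle B a :
  computable B a -> computable B (fun s => a s \in B : nat).
Proof.
move=> Ca rg b ib; have [c Hc] := Ca rg b ib.
(* One half of the split drives the oracle head to the queried cell, the other brings it back to 0,
   as [implements] demands. The split empties [b], so that [Query] leaves just the bit there. *)
exists (Seq c (Seq (clear b.+1) (Seq (clear b.+2) (Seq (split b b.+1 b.+2)
  (Seq (shift b.+1 Right) (Seq (Query b) (shift b.+2 Left))))))) => s.
have [s1 [E1 V1 P1]] := Hc s.
eexists; split.
- apply: ExSeq E1 _; do 2 apply: ExSeq (exec_clear _ _ _ _) _.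
  apply: ExSeq (exec_split _ _ _ _ _ _) _; try lia.
  apply: ExSeq (exec_shift _ _ _ _ _) _; apply: ExSeq (ExQuery _ _ _ _) _.
  set p := iter _ _ 0; have -> : p = s1 b.
    rewrite /p (_ : upd _ b 0 b.+1 = s1 b); last by upd_tac.
    by elim: (s1 b) => //= k ->.
  set f := upd _ b _; have := exec_shift B b.+2 Left f (s1 b).
  rewrite (_ : f b.+2 = s1 b); last by rewrite /f; upd_tac.
  rewrite (_ : iter (s1 b) (move_pos Left) (s1 b) = 0); first exact.
  rewrite /= (_ : forall k m, iter k (fun i => i.-1) m = m - k) ?subnn //.
  by elim=> [|k IH] m /=; rewrite ?subn0 // IH; lia.
- by rewrite -V1; upd_tac.
- by move=> r rb; rewrite -P1 //; upd_tac.
Qed.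

(** * Arithmetic *)

Lemma comp_app1 B f a : computable B (fun s => f (s 0)) -> computable B a ->
  computable B (fun s => f (a s)).
Proof. by move=> Cf Ca; apply: (comp_let Ca Cf). Qed.

Lemma comp_weak B a : computable B a -> computable B (fun s => a (fun i => s i.+1)).
Proof. exact: comp_ren. Qed.

Lemma comp_app2 B f a b : computable B (fun s => f (s 0) (s 1)) ->
  computable B a -> computable B b -> computable B (fun s => f (a s) (b s)).
Proof. by move=> Cf Ca Cb; apply: (comp_let Cb (comp_let (comp_weak Ca) Cf)). Qed.

Lemma comp_app3 B f a b c : computable B (fun s => f (s 0) (s 1) (s 2)) ->
  computable B a -> computable B b -> computable B c ->
  computable B (fun s => f (a s) (b s) (c s)).
Proof.
move=> Cf Ca Cb Cc; have Ca2 := comp_weak (comp_weak Ca).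
exact: (comp_let Cc (comp_let (comp_weak Cb) (comp_let Ca2 Cf))).
Qed.

Lemma comp_add B a b : computable B a -> computable B b ->
  computable B (fun s => a s + b s).
Proof.
apply: comp_app2.
have := @comp_rec B _ _ (fun k r s => r.+1) (comp_var B 0) (comp_var B 1)
  (comp_succ (comp_var B 1)).
apply: comp_ext => s; elim: (s 1) => [|n IH] /=; first by rewrite addn0.
by rewrite IH addnS.
Qed.

Lemma comp_mul B a b : computable B a -> computable B b ->
  computable B (fun s => a s * b s).
Proof.
apply: comp_app2.
have := @comp_rec B _ _ (fun k r s => r + s 0) (comp_const B 0) (comp_var B 1)
  (comp_add (comp_var B 1) (comp_var B 2)).
apply: comp_ext => s; elim: (s 1) => [|n IH] /=; first by rewrite muln0.
by rewrite IH mulnSr.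
Qed.

Lemma comp_exp B a b : computable B a -> computable B b ->
  computable B (fun s => a s ^ b s).
Proof.
apply: comp_app2.
have := @comp_rec B _ _ (fun k r s => r * s 0) (comp_const B 1) (comp_var B 1)
  (comp_mul (comp_var B 1) (comp_var B 2)).
apply: comp_ext => s; elim: (s 1) => [|n IH] //=.
by rewrite IH expnSr.
Qed.

Lemma comp_pred B a : computable B a -> computable B (fun s => (a s).-1).
Proof.
apply: comp_app1.
have := @comp_rec B _ _ (fun k r s => k) (comp_const B 0) (comp_var B 0)
  (comp_var B 0).
by apply: comp_ext => s; case: (s 0).
Qed.

Lemma comp_sub B a b : computable B a -> computable B b ->
  computable B (fun s => a s - b s).
Proof.
apply: comp_app2.
have := @comp_rec B _ _ (fun k r s => r.-1) (comp_var B 0) (comp_var B 1)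
  (comp_pred (comp_var B 1)).
apply: comp_ext => s; elim: (s 1) => [|n IH] /=; first by rewrite subn0.
by rewrite IH subnS.
Qed.

Lemma comp_leq B a b : computable B a -> computable B b ->
  computable B (fun s => a s <= b s).
Proof.
apply: (@comp_app2 _ (fun x y => x <= y : nat)).
have := comp_sub (comp_const B 1) (comp_sub (comp_var B 0) (comp_var B 1)).
by apply: comp_ext => s; rewrite /leq; case: (s 0 - s 1).
Qed.

Lemma comp_and B (p q : (nat -> nat) -> bool) :
  computable B (fun s => p s) -> computable B (fun s => q s) ->
  computable B (fun s => p s && q s).
Proof.
move=> Cp Cq; apply: comp_ext (comp_mul Cp Cq) => s.
by case: (p s); case: (q s).
Qed.

Lemma comp_neg B (p : (nat -> nat) -> bool) :
  computable B (fun s => p s) -> computable B (fun s => ~~ p s).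
Proof.
by move=> Cp; apply: comp_ext (comp_sub (comp_const B 1) Cp) => s; case: (p s).
Qed.

Lemma comp_or B (p q : (nat -> nat) -> bool) :
  computable B (fun s => p s) -> computable B (fun s => q s) ->
  computable B (fun s => p s || q s).
Proof.
move=> Cp Cq; apply: comp_ext (comp_neg (comp_and (comp_neg Cp) (comp_neg Cq))) => s.
by case: (p s); case: (q s).
Qed.

Lemma comp_eq B (a b : (nat -> nat) -> nat) : computable B a -> computable B b ->
  computable B (fun s => a s == b s).
Proof.
move=> Ca Cb; apply: comp_ext (comp_and (comp_leq Ca Cb) (comp_leq Cb Ca)) => s.
by rewrite eqn_leq.
Qed.

Lemma comp_if B (p : (nat -> nat) -> bool) a b :
  computable B (fun s => p s) -> computable B a -> computable B b ->
  computable B (fun s => if p s then a s else b s).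
Proof.
move=> Cp Ca Cb.
apply: comp_ext (comp_add (comp_mul Cp Ca) (comp_mul (comp_neg Cp) Cb)) => s.
by case: (p s); rewrite !(mul0n, mul1n) ?addn0.
Qed.

Lemma comp_has B (p : nat -> (nat -> nat) -> bool) n :
  computable B (fun s => p (s 0) (fun i => s i.+1)) -> computable B n ->
  computable B (fun s => has (p^~ s) (iota 0 (n s))).
Proof.
move=> Cp Cn.
(* In a recursion body variable 0 is the counter and variable 1 the accumulator; the renaming skips
   the latter. *)
have Cp' := comp_ren (fun i => if i is 0 then 0 else i.+1) Cp.
have Cor := comp_or (comp_neg (comp_eq (comp_var B 1) (comp_const B 0))) Cp'.
have := @comp_rec B _ _ (fun k r s => (r != 0) || p k s) (comp_const B 0) Cn Cor.
apply: comp_ext => s; elim: (n s) => [|m IH] //.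
rewrite -[in RHS]addn1 iotaD has_cat [LHS]/= IH /= orbF.
by case: has.
Qed.

Lemma comp_iter B F n a :
  computable B (fun s => F (s 0) (fun i => s i.+1)) ->
  computable B n -> computable B a ->
  computable B (fun s => iter (n s) (F^~ s) (a s)).
Proof.
move=> CF Cn Ca.
have CF' := comp_ren succn CF.
have := @comp_rec B _ _ (fun k r s => F r s) Ca Cn CF'.
by apply: comp_ext => s; elim: (n s) => //= m ->.
Qed.

(** The code of cons in the Gödel numbering: lists, pairs, entries and programs all have codes built
    from [pc] and 0. *)
Definition pc (a b : nat) : nat := 2 ^ a * b.*2.+1.
Definition hd (n : nat) : nat := head 0 (CodeSeq.decode n).
Definition tl (n : nat) : nat := CodeSeq.code (behead (CodeSeq.decode n)).

Lemma pcE a b : pc a b = CodeSeq.code (a :: CodeSeq.decode b).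
Proof. by rewrite /= CodeSeq.decodeK. Qed.

Lemma hd_pc a b : hd (pc a b) = a.
Proof. by rewrite pcE /hd CodeSeq.codeK. Qed.

Lemma tl_pc a b : tl (pc a b) = b.
Proof. by rewrite pcE /tl CodeSeq.codeK /= CodeSeq.decodeK. Qed.

Lemma pc_hd_tl n : n != 0 -> pc (hd n) (tl n) = n.
Proof.
rewrite -{1 4}(CodeSeq.decodeK n) /hd /tl; case: (CodeSeq.decode n) => //.
Qed.

Lemma pc_neq0 a b : pc a b != 0.
Proof. by rewrite /pc -lt0n muln_gt0 expn_gt0. Qed.

Lemma pc_gt a b : b < pc a b.
Proof.
apply: (@leq_trans b.*2.+1); first by lia.
by rewrite leq_pmull // expn_gt0.
Qed.

Lemma comp_pc B a b : computable B a -> computable B b ->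
  computable B (fun s => pc (a s) (b s)).
Proof.
move=> Ca Cb; have Cb2 := comp_succ (comp_add Cb Cb).
apply: comp_ext (comp_mul (comp_exp (comp_const B 2) Ca) Cb2) => s.
by rewrite /pc addnn.
Qed.

Lemma comp_hd B a : computable B a -> computable B (fun s => hd (a s)).
Proof.
apply: comp_app1.
(* The tail may be sought below [s 0] because [b < pc k b]. The first disjunct stops the search at
   once on the empty list, giving the default 0. *)
pose F k (s : nat -> nat) :=
  ~~ ((s 0 == 0) || has (fun b => pc k b == s 0) (iota 0 (s 0))) : nat.
apply: (@comp_mu _ F).
- apply: comp_neg; apply: comp_or.
    exact: comp_eq (comp_var _ _) (comp_const _ _).
  apply: (@comp_has _ (fun b s => pc (s 0) b == s 1)); last exact: comp_var.
  by apply: comp_eq; [apply: comp_pc|]; apply: comp_var.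
- move=> s; rewrite /F; case: eqP => //= /eqP n0.
  case: hasP => //; case; exists (tl (s 0)); rewrite ?pc_hd_tl //.
  by rewrite mem_iota add0n -[X in _ < X](pc_hd_tl n0) pc_gt.
- move=> s k lt; rewrite /F; case: eqP => /= [s0|_]; first by rewrite s0 in lt.
  by case: hasP => //= -[b _ /eqP E]; rewrite -E hd_pc ltnn in lt.
Qed.

Lemma comp_tl B a : computable B a -> computable B (fun s => tl (a s)).
Proof.
apply: comp_app1.
pose F k (s : nat -> nat) := ~~ ((s 0 == 0) || (pc (hd (s 0)) k == s 0)) : nat.
apply: (@comp_mu _ F).
- apply: comp_neg; apply: comp_or.
    exact: comp_eq (comp_var _ _) (comp_const _ _).
  by apply: comp_eq; [apply: comp_pc; first apply: comp_hd|]; apply: comp_var.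
- by move=> s; rewrite /F; case: eqP => //= /eqP n0; rewrite pc_hd_tl ?eqxx.
- move=> s k lt; rewrite /F; case: eqP => /= [s0|_]; first by rewrite s0 in lt.
  by case: eqP => //= E; rewrite -E tl_pc ltnn in lt.
Qed.

Ltac comp :=
  first [refine (comp_var _ _) | refine (comp_const _ _) |
  lazymatch goal with
  | |- computable _ (fun s => (@?a s).+1) => apply: comp_succ; comp
  | |- computable _ (fun s => (@?a s).-1) => apply: comp_pred; comp
  | |- computable _ (fun s => @?a s + @?b s) => apply: comp_add; comp
  | |- computable _ (fun s => @?a s * @?b s) => apply: comp_mul; comp
  | |- computable _ (fun s => @?a s - @?b s) => apply: comp_sub; comp
  | |- computable _ (fun s => nat_of_bool (@?a s <= @?b s)) => apply: comp_leq; comp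
  | |- computable _ (fun s => nat_of_bool (@?a s == @?b s)) => apply: comp_eq; comp
  | |- computable _ (fun s => nat_of_bool (@?a s && @?b s)) => apply: comp_and; comp
  | |- computable _ (fun s => nat_of_bool (@?a s || @?b s)) => apply: comp_or; comp
  | |- computable _ (fun s => nat_of_bool (~~ @?a s)) => apply: comp_neg; comp
  | |- computable _ (fun s => pc (@?a s) (@?b s)) => apply: comp_pc; comp
  | |- computable _ (fun s => hd (@?a s)) => apply: comp_hd; comp
  | |- computable _ (fun s => tl (@?a s)) => apply: comp_tl; comp
  | |- _ => first [by eauto | refine (comp_if _ _ _); comp | idtac]
  end].

(** * From programs to machines *)

Lemma rep_output N st q c : 1 < N -> rep N st q c -> output c = st.1 0.
Proof.
move=> N1 [z [w [z' [-> bz bz' _ cw]]]].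
have cb y : blank y -> count_mem 1 y = 0.
  by move=> by0; apply/count_memPn/negP => /(allP by0).
have ch y : count_mem 1 (head 0 y :: behead y) = count_mem 1 y by case: y.
by rewrite /output /= count_cat ch count_cat cw // cb // cb // addn0.
Qed.

Definition input (x : nat) : store := (upd (fun=> 0) 0 x, 0).

Lemma rep_init N x : 0 < N -> rep N (input x) 0 (init x).
Proof.
move=> N0; exists [::], (nseq x 1), [::]; rewrite cats0; split=> //.
  by apply/allP => a /nseqP[-> _]; lia.
move=> r _; rewrite count_nseq /input /upd /= eqSS eq_sym.
by case: eqP => _; rewrite ?mul1n ?mul0n.
Qed.

Lemma turing_computable B f :
  computable B (fun s => f (s 0)) -> turing_le f B.
Proof.
move=> Cf; have [c Hc] := Cf (fun=> 0) 1 (fun=> ltnSn 0).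
(* The output is read off as the number of symbols 1, that is, as register 0; so the input there is
   erased and the result moved in. *)
pose p := Seq c (Seq (clear 0) (pour 1 0)).
have [N0 bN0] := boundedP p; pose N := maxn N0 2.
have bN : bounded N p by apply: bounded_le bN0; rewrite /N; lia.
exists (compile N p 0 (width p)) => x.
have [s [E V _]] := Hc (input x).1.
have E1 : exec B p (input x) (upd (upd (upd s 0 0) 0 (s 1)) 1 0, 0).
  apply: ExSeq E _; apply: ExSeq (exec_clear _ _ _ _) _.
  have := @exec_pour B 1 0 (upd s 0 0) 0; rewrite (_ : _ 0 + _ = s 1).
    exact.
  by upd_tac.
have iN : rep N (input x) 0 (init x) by apply: rep_init; rewrite /N; lia.
have S : {subset compile N p 0 (width p) <= compile N p 0 (width p)} by [].
have [t [k [R Hk]]] := run_exec E1 bN (@det_compile _ _ _ _) S iN.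
exists t, k; split=> //.
- case: Hk => [z [w [z' [-> _ _ _ _]]]]; apply: step_none => e.
  by move=> /(@within_compile N p 0 (width p)) + Ee; rewrite Ee add0n ltnn.
- rewrite (rep_output _ Hk); first by rewrite /= /upd /= V.
  by rewrite /N; lia.
Qed.

(* The hard-wired argument x is put into register 1 by x increments that run
   before c; they are numbered backwards, after the states of c, so that the
   code of c is the same for all x. *)
Fixpoint preload (N : nat) (c : cmd) (x : nat) : machine :=
  let Q := (width c).+2 in
  if x is y.+1 then incr N 1 (Q + y.*2).+2 (Q + y.*2) ++ preload N c y
  else compile N (Move Stay) Q 1 ++ compile N c 1 (width c).+1.

Lemma preloadS N c x : let q := (width c).+2 + x.*2 in
  preload N c x.+1 = incr N 1 q.+2 q ++ preload N c x.
Proof. by []. Qed.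

(** State 0 jumps to the first of the [x] increments; these lead down to the state [(width c).+2],
    which enters [c] at state 1. The state [(width c).+1] has no entries and is the halting
    state. *)
Definition specialize (N : nat) (c : cmd) (x : nat) : machine :=
  compile N (Move Stay) 0 ((width c).+2 + x.*2) ++ preload N c x.

Lemma det_catC M1 M2 : det (M1 ++ M2) -> det (M2 ++ M1).
Proof.
by move=> D k a a' H1 H2; apply: (D k); rewrite mem_cat orbC -mem_cat.
Qed.

Lemma preload_within N c x : within 1 ((width c).+3 + x.*2).+1 (preload N c x).
Proof.
elim: x => [|x IH]; last rewrite preloadS.
  apply: within_cat; first by apply: within_row; lia.
  by apply: (within_sub _ _ (@within_compile _ _ _ _)); lia.
apply: within_cat; first by apply: (within_sub _ _ (@within_incr _ _ _ _)); lia.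
by apply: (within_sub _ _ IH); lia.
Qed.

Lemma preload_det N c x : det (preload N c x).
Proof.
elim: x => [|x IH]; last rewrite preloadS.
  (* The list runs from high states to low ones, whereas [det_cat] expects increasing ranges. *)
  apply: det_catC.
  apply: (@det_cat 1 (1 + width c) (width c).+3); try exact: det_compile.
    exact: within_compile.
  by apply: within_row; lia.
apply: det_catC; apply: (@det_cat 1 _ _ _ _ _ (@within_incr _ _ _ _)) => //;
  last exact: det_incr.
by apply: (within_sub _ _ (@preload_within _ _ _)); lia.
Qed.

Lemma preload_exit N c x e : e \in preload N c x -> e.1.1.1 <> (width c).+1.
Proof.
elim: x => [|x IH]; rewrite ?preloadS mem_cat => /orP[].
- by move=> /mem_row[s [b [_ -> _]]] /=; lia.
- by move=> /within_compile; lia.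
- by move=> /within_incr; lia.
- exact: IH.
Qed.

Lemma specialize_det N c x : det (specialize N c x).
Proof.
apply: (det_cat (mid := 1) _ (@preload_within _ _ _)); last exact: preload_det.
- exact: (@within_compile _ (Move Stay)).
- exact: det_compile.
Qed.

Lemma specialize_exit N c x e : e \in specialize N c x -> e.1.1.1 <> (width c).+1.
Proof.
rewrite mem_cat => /orP[/mem_row[s [b [_ -> _]]] //|].
exact: preload_exit.
Qed.

Lemma preload_sub N c x : {subset preload N c 0 <= preload N c x}.
Proof. by elim: x => // x IH e /IH; rewrite preloadS mem_cat orbC => ->. Qed.

Lemma run_preload B N c x j f q0 k M : 2 < N -> det M ->
    {subset preload N c x <= M} -> f 1 = j -> q0 = (width c).+2 + x.*2 ->
    rep N (f, 0) q0 k ->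
  exists t k', run B M t k k' /\ rep N (upd f 1 (j + x), 0) 1 k'.
Proof.
move=> N2 D; elim: x j f q0 k => [|x IH] j f q0 k S fj -> Hk.
  have S0 := @cat_subl (compile N (Move Stay) (width c).+2 1) _ M S.
  rewrite addn0 in Hk.
  have [t [k' [R Hk']]] := run_exec (ExMove B Stay f 0) (erefl _) D S0 Hk.
  exists t, k'; split=> //; rewrite addn0 (_ : upd f 1 j = f) //.
  by apply/funext => y; upd_tac.
rewrite preloadS in S.
have Hk1 : rep N (f, 0) ((width c).+2 + x.*2).+2 k.
  by rewrite doubleS !addnS in Hk.
have [t [k1 [R1 H1]]] := @run_incr B _ _ _ _ _ _ _ _ D (cat_subl S) N2 Hk1.
have [|t2 [k2 [R2 H2]]] := IH j.+1 _ _ _ (cat_subr S) _ (erefl _) H1.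
  by rewrite -fj; upd_tac.
exists (t.+1 + t2), k2; split; first exact: run_trans R1 R2.
rewrite (_ : upd f 1 _ = upd (upd f 1 (f 1).+1) 1 (j.+1 + x)) //.
by apply/funext => y; upd_tac.
Qed.

Lemma run_specialize B N c x y : 2 < N ->
  exists t k, run B (specialize N c x) t (init y) k /\
    rep N (upd (input y).1 1 x, 0) 1 k.
Proof.
move=> N2; have D := @specialize_det N c x.
have I : rep N (input y) 0 (init y) by apply: rep_init; lia.
have S : {subset specialize N c x <= specialize N c x} by [].
have [t [k [R Hk]]] :=
  run_exec (ExMove B Stay (input y).1 0) (erefl _ : bounded N (Move Stay)) D
    (cat_subl S) I.
have [|t2 [k2 [R2 Hk2]]] :=
  @run_preload B _ _ _ 0 _ _ _ _ N2 D (cat_subr S) _ (erefl _) Hk.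
  by [].
by exists (t + t2), k2; split=> //; apply: run_trans R R2.
Qed.

(** * Deciding r.e. conditions in the jump *)

Lemma pickle_pair (T U : countType) (x : T) (y : U) :
  pickle (x, y) = pc (pickle x) (pc (pickle y) 0).
Proof. by []. Qed.

Lemma pickle_cons (T : countType) (x : T) (s : seq T) :
  pickle (x :: s) = pc (pickle x) (pickle s).
Proof. by []. Qed.

Lemma pickle_cat (T : countType) (s1 s2 : seq T) :
  pickle (s1 ++ s2) = foldr pc (pickle s2) (map pickle s1).
Proof. by elim: s1 => //= x s1 IH; rewrite pickle_cons IH. Qed.

(** The keys form a fixed finite list, so the code is a fixed number of applications of [pc]. The
    code [a] of the entries that follow is a parameter, which lets rows be chained. *)
Lemma comp_row B N q (f : (nat -> nat) -> nat -> bool -> action) a :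
    computable B q -> computable B a ->
    (forall i b, computable B (fun s => pickle (f s i b))) ->
  computable B (fun s => foldr pc (a s) (map pickle (row N (q s) (f s)))).
Proof.
move=> Cq Ca Cf.
have -> : (fun s => foldr pc (a s) (map pickle (row N (q s) (f s)))) =
  (fun s => foldr (fun k : nat * bool => pc (pc (pc (pc (q s) (pc k.1 0)) (pc k.2 0))
                                   (pc (pickle (f s k.1 k.2)) 0)))
                  (a s) (keys N)).
  by apply/funext => s; rewrite rowE; elim: (keys N) => //= k l ->.
elim: (keys N) => //= -[i b] l IH; comp.
Qed.

Lemma comp_action B e i d d' : computable B e ->
  computable B (fun s => pickle ((e s, i, d, d') : action)).
Proof.
move=> Ce; have Ci j : computable B (fun=> pc j 0) by exact: comp_const.
exact: comp_pc (comp_pc (comp_pc Ce (Ci i)) (Ci (pickle d))) (Ci (pickle d')).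
Qed.

Lemma comp_incr B N r q e a : computable B q -> computable B e ->
  computable B a ->
  computable B (fun s => foldr pc (a s) (map pickle (incr N r (q s) (e s)))).
Proof.
move=> Cq Ce Ca; rewrite /incr.
have -> : (fun s => foldr pc (a s) (map pickle (incr N r (q s) (e s)))) =
  (fun s => foldr pc (foldr pc (a s)
      (map pickle (row N (q s).+1 (home (q s).+1 (e s)))))
    (map pickle (row N (q s) (search (q s) 0 0 0 (q s).+1 r.+1)))).
  by apply/funext => s; rewrite map_cat foldr_cat.
apply: comp_row => //; last first.
  by move=> i b; rewrite /search; case: (i == 0); apply: comp_action; comp.
apply: comp_row => //; first exact: comp_succ.
by move=> i b; rewrite /home; case: (i == 0); apply: comp_action; comp.
Qed.

(** The effective part of the s-m-n theorem: the code of [c] enters as a constant, and recursion on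
    the argument prepends the increments one by one. *)
Lemma comp_specialize B N c :
  computable B (fun s => pickle (specialize N c (s 0))).
Proof.
pose Q := (width c).+2.
pose p x := nat_rec (fun=> nat) (pickle (preload N c 0))
  (fun y r => foldr pc r (map pickle (incr N 1 (Q + (y + y)).+2 (Q + (y + y))))) x.
have pE x : p x = pickle (preload N c x).
  by elim: x => //= x IH; rewrite -[p x]/(p x) IH addnn -pickle_cat.
have Cp : computable B (fun s => p (s 0)).
  apply: (@comp_rec B (fun=> _) _ (fun y r s =>
    foldr pc r (map pickle (incr N 1 (Q + (y + y)).+2 (Q + (y + y)))))); comp.
  by apply: comp_incr; comp.
have -> : (fun s => pickle (specialize N c (s 0))) =
  (fun s => foldr pc (p (s 0)) (map pickle (row N 0
    (fun i b => (Q + (s 0 + s 0), i, Stay, Stay))))).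
  by apply/funext => s; rewrite pE addnn -pickle_cat.
by apply: comp_row => //; [comp|move=> i b; apply: comp_action; comp].
Qed.

Lemma iter_step_None B M n : iter n (obind (step B M)) None = None.
Proof. by elim: n => //= n ->. Qed.

(** Register 0 receives the input, 1 the argument [x], 2 the candidate and 3 the test value. The
    test depends only on registers 1 and 2, so halting is the same for every input [y]. *)
Lemma halts_specialize B F c1 N x y :
    implements B c1 (fun s => F (s 0) (s 1)) (scons 2 (fun=> 1)) 3 ->
    let c := Seq c1 (While 3 (Seq (Inc 2) c1)) in
    bounded N c -> 2 < N ->
  halts B (specialize N c x) y <-> exists n, F n x = 0.
Proof.
move=> H1 c bN N2; set M := specialize N c x.
have D : det M by exact: specialize_det.
have [t0 [k0 [R0 Hk0]]] := run_specialize B c x y N2; rewrite -/M in R0.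
set s0 := upd (input y).1 1 x in Hk0.
have S : {subset compile N c 1 (width c).+1 <= M}.
  move=> e He; rewrite /M /specialize mem_cat; apply/orP; right.
  apply: (@preload_sub N c x).
  have : e \in compile N (Move Stay) (width c).+2 1 ++ compile N c 1 (width c).+1.
    by rewrite mem_cat He orbT.
  exact.
have H1' : implements B c1 (fun s => (fun n t => F n (t 0)) (s 0) (fun i => s i.+1))
  (scons 2 (fun=> 1)) 3 by [].
split=> [[z [th [kh [Rh Sh _]]]]|[n Fn]]; last first.
  have nx : exists n, F n x == 0 by exists n; apply/eqP.
  case: (ex_minnP nx) => m /eqP Fm mmin.
  have [||||s' [E _ _]] :=
    @exec_search B (fun n t => F n (t 0)) (fun=> 1) 2 c1 m s0 _ H1'.
  - by [].
  - exact: Fm.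
  - by move=> k km /eqP /mmin; lia.
  - by [].
  have [t [k [R Hk]]] := run_exec E bN D S Hk0.
  exists (output k), (t0 + t), k; split=> //; first exact: run_trans R0 R.
  case: Hk => [w [w1 [w2 [-> _ _ _ _]]]]; apply: step_none => e.
  exact: specialize_exit.
apply: contrapT => nex; have Fx n : F n x <> 0 by move=> Fn; apply: nex; exists n.
have S1 : {subset compile N c1 1 (1 + width c1) <= M} := cat_subl S.
have S2 : {subset compile N (While 3 (Seq (Inc 2) c1)) (1 + width c1) (width c).+1
  <= M} := cat_subr S.
have S3 : {subset compile N (Seq (Inc 2) c1) (1 + width c1).+3 (1 + width c1) <= M}
  := cat_subr (cat_subr (cat_subr S2)).
have [N3 bN1] : 4 < N /\ bounded N c1 by move: bN => /= /andP[-> /andP[-> _]].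
(* Divergence has no [exec] derivation, so it is shown on the machine itself: control returns to the
   loop head with a non-zero test value for ever. *)
pose I k := exists s, [/\ rep N (s, 0) (1 + width c1) k, s 3 <> 0 & s 1 = x].
have stepI k : I k -> exists t k', run B M t.+1 k k' /\ I k'.
  move=> [s [Hk s3 s1]].
  have [t [k' [R Hk']]] := @run_test B _ _ _ _ _ _ _ _ _ D S2 N3 s3 Hk.
  have [s' [E V P]] := H1 (upd s 2 (s 2).+1).
  have E' : exec B (Seq (Inc 2) c1) (s, 0) (s', 0) by apply: ExSeq (ExInc _ _ _ _) E.
  have bN' : bounded N (Seq (Inc 2) c1) by rewrite /= bN1; lia.
  have [t' [k2 [R' Hk2]]] := run_exec E' bN' D S3 Hk'.
  exists (t + t'), k2; split; first exact: run_trans R R'.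
  exists s'; split=> //; last by rewrite P.
  by rewrite V /upd /= s1.
have [s' [E V P]] := H1 s0.
have [t1 [k1 [R1 Hk1]]] := run_exec E bN1 D S1 Hk0.
have Ik1 : I k1 by exists s'; split=> //; [rewrite V|rewrite P].
(* From [k1] on, the machine would outlive the time [th] at which it halts. *)
have := run_forever stepI (t := th.+1) Ik1; rewrite -(run_trans R0 R1).
by rewrite -iterD addnC iterD iterS Rh /= Sh; case; exact: iter_step_None.
Qed.

Lemma comp_exists B F : computable B (fun s => F (s 0) (s 1)) ->
  computable (jump B) (fun s => `[< exists n, F n (s 0) = 0 >]).
Proof.
move=> CF; have ib i : scons 2 (fun=> 1) i < 3 by case: i => [|[]].
have [c1 H1] := CF _ _ ib; pose c := Seq c1 (While 3 (Seq (Inc 2) c1)).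
have [N0 bN0] := boundedP c; pose N := maxn N0 3.
have bN : bounded N c by apply: bounded_le bN0; rewrite /N; lia.
(* A single query asks whether the specialized machine halts on its own code; halting being
   independent of the input, this is the condition on [s 0]. *)
apply: comp_ext (comp_oracle (@comp_specialize (jump B) N c)) => s.
congr nat_of_bool; have N2 : 2 < N by rewrite /N; lia.
have HS := halts_specialize (s 0) (pickle (specialize N c (s 0))) H1 bN N2.
apply/idP/asboolP; rewrite in_setE -HS; last by exists (specialize N c (s 0)).
by move=> [M [/(pcan_inj pickleK) <-]].
Qed.

(** * The universal function *)

(** The code of the suffix of [m] that starts at the first entry with key [k], or 0. As a list is no
    longer than its code, [m] rounds suffice. *)
Definition lookup (m k : nat) : nat :=
  iter m (fun r => if (r == 0) || (hd (hd r) == k) then r else tl r) m.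

(** The final [pc 0 0] holds the oracle bit false. *)
Definition ulookup (m c : nat) : nat :=
  lookup m (pc (pc (hd c) (pc (hd (tl (tl c))) 0)) (pc 0 0)).

Definition umove (d q l s r : nat) : nat :=
  if d == 0 then pc q (pc (tl l) (pc (hd l) (pc s r)))
  else if d == 1 then pc q (pc l (pc s r))
  else pc q (pc (pc s l) (pc (hd r) (tl r))).

Definition uact (a c : nat) : nat :=
  umove (hd (tl (hd a))) (hd (hd (hd a))) (hd (tl c)) (hd (tl (hd (hd a))))
    (tl (tl (tl c))).

(** Halted configurations are fixed points, so a result persists at all later times. *)
Definition ustep (m c : nat) : nat :=
  if ulookup m c == 0 then c else uact (hd (tl (hd (ulookup m c)))) c.

Definition ones (n : nat) : nat := count_mem 1 (CodeSeq.decode n).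

Definition uoutput (c : nat) : nat :=
  ones (hd (tl c)) + ((hd (tl (tl c)) == 1) + ones (tl (tl (tl c)))).

Definition uinit (x : nat) : nat :=
  pc 0 (pc 0 (pc (0 < x) (iter x.-1 (pc 1) 0))).

(* The output is shifted by 1, the value 0 standing for a run that has not halted
   after t steps. *)
Definition univ (m x t : nat) : nat :=
  if ulookup m (iter t (ustep m) (uinit x)) == 0
  then (uoutput (iter t (ustep m) (uinit x))).+1 else 0.

Lemma code_size s : size s <= CodeSeq.code s.
Proof. by elim: s => //= n s IH; apply: leq_ltn_trans IH (pc_gt n _). Qed.

(** A primitive recursive form of the count. Running over [n] positions covers the list, and beyond
    its end [hd] gives 0, which is not counted. *)
Lemma onesE n :
  ones n = nat_rec (fun=> nat) 0 (fun k r => r + (hd (iter k tl n) == 1)) n.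
Proof.
have tlE k : iter k tl n = CodeSeq.code (drop k (CodeSeq.decode n)).
  elim: k => [|k IH] /=; first by rewrite drop0 CodeSeq.decodeK.
  by rewrite IH /tl CodeSeq.codeK -drop1 drop_drop.
have le : size (CodeSeq.decode n) <= n.
  by rewrite -[X in _ <= X](CodeSeq.decodeK n) code_size.
rewrite /ones -(take_oversize le).
elim: {1 4}n {le} => [|k IH] /=; first by rewrite take0.
rewrite -IH tlE /hd CodeSeq.codeK -nth0 nth_drop addn0.
have [lt|le] := ltnP k (size (CodeSeq.decode n)).
  by rewrite (take_nth 0 lt) -cats1 count_cat /= addn0.
by rewrite !take_oversize ?nth_default ?addn0 //; lia.
Qed.

Lemma comp_ones B a : computable B a -> computable B (fun s => ones (a s)).
Proof.
apply: comp_app1.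
have Ctl : computable B (fun s => iter (s 0) tl (s 2)).
  apply: (@comp_iter B (fun x _ => tl x)); comp.
have := @comp_rec B (fun=> 0) (fun s => s 0)
  (fun k r s => r + (hd (iter k tl (s 0)) == 1)).
move=> H; apply: comp_ext (H _ _ _) => [s|||]; [by rewrite onesE|comp|comp|comp].
Qed.

Lemma comp_lookup B a b : computable B a -> computable B b ->
  computable B (fun s => lookup (a s) (b s)).
Proof.
apply: comp_app2; rewrite /lookup.
apply: (@comp_iter B
  (fun r s => if (r == 0) || (hd (hd r) == s 1) then r else tl r)); comp.
Qed.

Lemma comp_ulookup B a b : computable B a -> computable B b ->
  computable B (fun s => ulookup (a s) (b s)).
Proof. by move=> Ca Cb; apply: comp_lookup => //; comp. Qed.

Lemma comp_uact B a b : computable B a -> computable B b ->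
  computable B (fun s => uact (a s) (b s)).
Proof. by move=> Ca Cb; rewrite /uact /umove; comp. Qed.

Lemma comp_ustep B a b : computable B a -> computable B b ->
  computable B (fun s => ustep (a s) (b s)).
Proof.
move=> Ca Cb; have Cl := comp_ulookup Ca Cb; rewrite /ustep.
by apply: comp_if => //; [comp|apply: comp_uact => //; comp].
Qed.

Lemma comp_uoutput B a :
  computable B a -> computable B (fun s => uoutput (a s)).
Proof.
move=> Ca; apply: comp_add; last apply: comp_add; try (apply: comp_ones; comp).
by comp.
Qed.

Lemma comp_univ B a b c : computable B a -> computable B b -> computable B c ->
  computable B (fun s => univ (a s) (b s) (c s)).
Proof.
apply: comp_app3; rewrite /univ.
have Ci : computable B (fun s => uinit (s 1)).
  rewrite /uinit; comp.
  apply: (@comp_iter B (fun x _ => pc 1 x)); comp.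
have Cs : computable B (fun s => iter (s 2) (ustep (s 0)) (uinit (s 1))).
  apply: (@comp_iter B (fun x s => ustep (s 0) x)) => //; last by comp.
  by apply: comp_ustep; comp.
apply: comp_if; last by comp.
  by apply: comp_eq; [apply: comp_ulookup => //|]; comp.
by apply: comp_succ; apply: comp_uoutput.
Qed.

Lemma lookupE (M : machine) (k : nat * nat * bool) :
  lookup (pickle M) (pickle k) =
    pickle (drop (find (fun e => e.1 == k) M) M).
Proof.
rewrite /lookup; set F := fun r => _.
have Ffix n x : F x = x -> iter n F x = x by move=> H; elim: n => //= n ->.
have : size M <= pickle M.
  by apply: leq_trans (code_size _); rewrite size_map.
move: {1 2}(pickle M) => n; elim: M n => [|e M IH] n /=.
  by move=> _; apply: Ffix.
have FE : F (pickle (e :: M)) = if e.1 == k then pickle (e :: M) else pickle M.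
  rewrite /F (negPf (pc_neq0 _ _)) /= hd_pc tl_pc; case: e => e1 e2.
  by rewrite pickle_pair hd_pc (inj_eq (pcan_inj pickleK)).
case: eqP FE => [_ FE _|_ FE lt]; first exact: Ffix.
by case: n lt => // n lt; rewrite iterSr FE; apply: IH.
Qed.

(** The oracle position is dropped, since the empty oracle answers alike everywhere. *)
Definition encode (c : config) : nat :=
  let: Config q (l, s, r) _ := c in pc q (pc (pickle l) (pc s (pickle r))).

Lemma filter_find (T : Type) (p : pred T) (s : seq T) :
  filter p s = if drop (find p s) s is x :: s' then x :: filter p s' else [::].
Proof. by elim: s => //= x s IH; case: (p x). Qed.

Lemma pickle_behead (s : seq nat) : pickle (behead s) = tl (pickle s).
Proof. by case: s => // a s; rewrite pickle_cons tl_pc. Qed.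

Lemma pickle_head (s : seq nat) : head 0 s = hd (pickle s).
Proof. by case: s => // a s; rewrite pickle_cons hd_pc. Qed.

Lemma ustepE (M : machine) c :
  (ulookup (pickle M) (encode c) == 0) = ~~ step set0 M c /\
  ustep (pickle M) (encode c) = encode (odflt c (step set0 M c)).
Proof.
case: c => q [[l s] r] i; rewrite /ustep.
have -> : ulookup (pickle M) (encode (Config q (l, s, r) i)) =
    lookup (pickle M) (pickle (q, s, false)).
  by rewrite /ulookup /= !(hd_pc, tl_pc).
rewrite lookupE /step (_ : i \in set0 = false); last by rewrite in_set0.
rewrite filter_find; case: drop => [|[k [[[q' s'] d] d']] M'] //=.
rewrite pickle_cons (negPf (pc_neq0 _ _)); split=> //.
rewrite hd_pc pickle_pair tl_pc hd_pc /uact !pickle_pair !(hd_pc, tl_pc).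
by case: d; rewrite /umove /= ?pickle_behead ?pickle_head ?pickle_cons.
Qed.

Lemma uinitE x : uinit x = encode (init x).
Proof.
rewrite /uinit /init /=; case: x => //= x; congr (pc _ (pc _ (pc _ _))).
by elim: x => //= x IH; rewrite IH.
Qed.

Lemma uoutputE c : uoutput (encode c) = output c.
Proof.
case: c => q [[l s] r] i; rewrite /uoutput /output /= !(hd_pc, tl_pc) /ones.
rewrite count_cat /=; congr (count_mem 1 _ + (_ + count_mem 1 _)).
- by rewrite /pickle /= CodeSeq.codeK map_id.
- by rewrite /pickle /= CodeSeq.codeK map_id.
Qed.

Lemma univ_mono m x t t' y : t <= t' -> univ m x t = y.+1 -> univ m x t' = y.+1.
Proof.
move=> /subnK <-; elim: (t' - t) => //= n IH /IH; rewrite /univ addSn iterS.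
set c := iter _ _ _; case: ifP => // H E.
by rewrite (_ : ustep m c = c) ?H // /ustep H.
Qed.

Lemma univP (M : machine) x y :
  computes set0 M x y <-> exists t, univ (pickle M) x t = y.+1.
Proof.
split=> [[t [c [R H <-]]]|[t]].
  exists t; rewrite /univ (_ : iter t _ _ = encode c).
    by have [-> _] := ustepE M c; rewrite H /= uoutputE.
  elim: t c R {H} => [|t IH] c /=; first by move=> [<-]; rewrite uinitE.
  case E: (iter t _ (Some _)) => [c'|] //= H; rewrite (IH _ E).
  by have [_ ->] := ustepE M c'; rewrite H.
rewrite /univ.
(* Simulated configurations are reached ones, but [n] may be smaller than [t], since the simulation
   idles after halting. *)
have [n [c [R ->]]] : exists n c,
  iter n (obind (step set0 M)) (Some (init x)) = Some c /\
  iter t (ustep (pickle M)) (uinit x) = encode c.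
  elim: t => [|t [n [c [R IH]]]]; first by exists 0, (init x); rewrite uinitE.
  rewrite iterS IH; have [_ ->] := ustepE M c.
  case E: (step set0 M c) => [c'|]; last by exists n, c.
  by exists n.+1, c'; rewrite iterS R /= E.
have [-> _] := ustepE M c; case E: (step set0 M c) => [c'|] //= [<-].
by exists n, c; split=> //; rewrite uoutputE.
Qed.

Lemma computes_fun M x y y' :
  computes set0 M x y -> computes set0 M x y' -> y = y'.
Proof.
move=> /univP[t H] /univP[t' H'].
have := univ_mono (leq_maxl t t') H; rewrite (univ_mono (leq_maxr t t') H').
by case.
Qed.

(** * The upper bound *)

Lemma comp_ex B (P : nat -> nat -> bool) a :
  computable B (fun s => P (s 0) (s 1)) -> computable (jump B) a ->
  computable (jump B) (fun s => `[< exists n, P n (a s) >]).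
Proof.
move=> CP; apply: (@comp_app1 _ (fun x => `[< exists n, P n x >] : nat)).
have := @comp_exists B (fun n x => ~~ P n x) (comp_neg CP).
apply: comp_ext => s; congr nat_of_bool; apply: asbool_equiv_eq.
by split=> -[n H]; exists n; move: H; case: (P n _).
Qed.

Lemma comp_search B (P : nat -> nat -> bool) :
  computable B (fun s => P (s 0) (s 1)) -> (forall x, exists n, P n x) ->
  exists2 h : nat -> nat, computable B (fun s => h (s 0)) & forall x, P (h x) x.
Proof.
move=> CP ex; exists (fun x => ex_minn (ex x)); last by move=> x; case: ex_minnP.
apply: (@comp_mu B (fun n s => ~~ P n (s 0))); first exact: comp_neg.
- by move=> s; case: ex_minnP => m ->.
- by move=> s k; case: ex_minnP => m _ H; case E: (P k _) => //; have := H _ E; lia.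
Qed.

(** The way back from machines without oracle to [computable]: search for a sufficient number of
    steps of the universal function. *)
Lemma comp_machine B M G f : computable B (fun s => G (s 0)) ->
  (forall x, computes set0 M (G x) (f x)) -> computable B (fun s => f (s 0)).
Proof.
move=> CG H; pose P t x := univ (pickle M) (G x) t != 0.
have CU : computable B (fun s => univ (pickle M) (G (s 1)) (s 0)).
  by apply: comp_univ; [comp|apply: comp_app1 CG _; comp|comp].
have [|x|h Ch Ph] := @comp_search B P; first by rewrite /P; comp.
  by have [t Et] := (univP _ _ _).1 (H x); exists t; rewrite /P Et.
have C2 := comp_app2 (f := fun t x => (univ (pickle M) (G x) t).-1)
  (comp_pred CU) Ch (comp_var B 0).
apply: comp_ext C2 => s; have := Ph (s 0); rewrite /P.
case E: univ => [|y] // _; apply: computes_fun (H (s 0)).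
by apply/univP; exists (h (s 0)).
Qed.

Lemma pickle_decode d : pickle (CodeSeq.decode d) = d.
Proof. by rewrite -[RHS]CodeSeq.decodeK -[in RHS](map_id (CodeSeq.decode d)). Qed.

Lemma decode_pickle (w : word) : CodeSeq.decode (pickle w) = w.
Proof. by rewrite -[RHS](map_id w) -[RHS]CodeSeq.codeK. Qed.

Lemma comp_decidable B (X : set word) : recursive X ->
  computable B (fun s => CodeSeq.decode (s 0) \in X).
Proof.
move=> [M HM]; apply: (@comp_machine B M id (fun d => CodeSeq.decode d \in X)).
  exact: comp_var.
by move=> d; rewrite -{1}(pickle_decode d); apply: HM.
Qed.

(** Runs the conversion procedure [P] on [D] and the machine it yields on [w], each for [t] steps;
    results are shifted by 1 as in [univ]. *)
Definition eval (P D w t : nat) : nat :=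
  if univ P D t == 0 then 0 else univ (univ P D t).-1 w t.

Lemma comp_eval B P a b c : computable B a -> computable B b -> computable B c ->
  computable B (fun s => eval P (a s) (b s) (c s)).
Proof.
move=> Ca Cb Cc; have CU := comp_univ (comp_const B P) Ca Cc.
apply: comp_if; [|exact: comp_const|]; first by comp.
by apply: comp_univ; comp.
Qed.

Lemma evalP P M D w y : computes set0 P D (pickle M) ->
  computes set0 M w y <-> exists t, eval (pickle P) D w t = y.+1.
Proof.
move=> HP; split=> [/univP[t Ht]|[t]].
  have [t' Ht'] := (univP _ _ _).1 HP; exists (maxn t t'); rewrite /eval.
  by rewrite (univ_mono (leq_maxr _ _) Ht') /= (univ_mono (leq_maxl _ _) Ht).
rewrite /eval; case E: (univ _ D t) => [|e] //= H.
have Ee : e = pickle M by apply: computes_fun HP; apply/univP; exists t.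
by apply/univP; exists t; rewrite -Ee.
Qed.

Lemma eval_mono P D w t t' y :
  t <= t' -> eval P D w t = y.+1 -> eval P D w t' = y.+1.
Proof.
move=> le; rewrite /eval; case E: (univ P D t) => [|e] //=.
by rewrite (univ_mono le E) /=; apply: univ_mono.
Qed.

(** * From deciding equivalence to a bound *)

Lemma finite_bound (T : choiceType) (X : set T) (w : T -> nat) :
  finite_set X -> exists K, forall x, X x -> w x <= K.
Proof.
move=> /finite_seqP[s ->]; exists (\max_(x <- s) w x) => x /= xs.
exact: leq_bigmax_seq.
Qed.

(** Finitely many sizes, each taken finitely often, leave finitely many descriptors; [K] bounds the
    sizes of chosen equivalents. *)
Lemma bound_bounded S1 S2 c1 c2 A n0 : complexity_measure S1 c1 ->
    (forall D, descriptors_over S1 A D -> c1 D <= n0) ->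
  exists K, upper_bound A S1 S2 c1 c2 (fun n => n + K).
Proof.
move=> hc1 le; have fX : finite_set (descriptors_over S1 A).
  apply: (@sub_finite_set _ _ (\bigcup_(n in `I_n0.+1)
    [set D | descriptors_over S1 A D /\ c1 D = n])).
    by move=> D XD; exists (c1 D) => //=; rewrite ltnS le.
  by apply: bigcup_finite => [|n _]; [exact: finite_II|exact: (cm_finite hc1)].
have /choice[w Hw] D : exists k, languages S2 (lang S1 D) ->
    exists2 D2, descriptors_of S2 (lang S1 D) D2 & c2 D2 <= k.
  have [[D2 HD2 E]|H] := pselect (languages S2 (lang S1 D)); last by exists 0.
  by exists (c2 D2) => _; exists D2.
have [K HK] := finite_bound w fX; exists K; split=> [n|D XD /Hw[D2 H2 le2]].
  by rewrite leq_addr.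
by exists D2 => //; have := HK _ XD; lia.
Qed.

(** By monotonicity all descriptors of size at most [n] occur before the first position of larger
    size, which a search finds. Whether an equivalent exists costs the one jump over [B]. *)
Lemma bound_unbounded B S1 S2 c1 c2 A (g : nat -> word) E :
    complexity_measure S1 c1 ->
    complexity_measure S2 c2 ->
    turing_le (fun i => pickle (g i)) set0 -> range g = descriptors_over S1 A ->
    (forall i j, i <= j -> c1 (g i) <= c1 (g j)) ->
    (forall n, exists i, n < c1 (g i)) ->
    computable B (fun s => E (s 0) (s 1) : bool) ->
    (forall i d, E i d <->
       descriptors_of S2 (lang S1 (g i)) (CodeSeq.decode d)) ->
  exists2 f, upper_bound A S1 S2 c1 c2 f & turing_le f (jump B).
Proof.
move=> hc1 hc2 [Mg Hg] rg mono unb CE HE.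
have Cg : computable (jump B) (fun s => pickle (g (s 0))).
  exact: (@comp_machine _ Mg id (fun i => pickle (g i)) (comp_var _ 0)).
have Dg i : descriptors_over S1 A (g i) by rewrite -rg; exists i.
have [M1 H1] := cm_recursive hc1; have [M2 H2] := cm_recursive hc2.
have Cc : computable (jump B) (fun s => c1 (g (s 0))).
  apply: (@comp_machine _ M1 (fun i => pickle (g i)) (fun i => c1 (g i)) Cg) => i.
  by apply: H1; case: (Dg i).
have [|N CN HN] := @comp_search (jump B) (fun i n => n < c1 (g i)) _ unb.
  by have C1 := comp_app1 (f := fun i => c1 (g i)) Cc (comp_var _ 0); comp.
have CEx : computable (jump B) (fun s => `[< exists d, E (s 0) d >]).
  apply: (@comp_ex B (fun d i => E i d)); last by comp.
  exact: comp_ren (fun i => if i is 0 then 1 else 0) CE.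
(* A dummy quantifier lifts [E] from [B] to its jump. *)
have CE' : computable (jump B) (fun s => E (s 0) (s 1)).
  have C2 : computable B (fun s => E (hd (s 1)) (tl (s 1))).
    by apply: (comp_app2 (f := fun i d => E i d : nat)) CE _ _; comp.
  have := @comp_ex B (fun _ x => E (hd x) (tl x)) (fun s => pc (s 0) (s 1)) C2.
  move=> H; apply: comp_ext (H _) => [s|]; last by comp.
  congr nat_of_bool; rewrite hd_pc tl_pc.
  by apply/asboolP/idP => [[]|] //; exists 0.
(* The witness [t] pairs an equivalent descriptor with a number of steps in which its size gets
   computed; the first disjunct ends the search if there is none. *)
pose P t i := ~~ `[< exists d, E i d >] ||
  (E i (hd t) && (univ (pickle M2) (hd t) (tl t) != 0)).
have [||t Ct Ht] := @comp_search (jump B) P.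
- have CEx1 :=
    comp_app1 (f := fun i => `[< exists d, E i d >] : nat) CEx (comp_var _ 1).
  have CE1 : computable (jump B) (fun s => E (s 1) (hd (s 0))).
    by apply: (comp_app2 (f := fun i d => E i d : nat)) CE' _ _; comp.
  have CU : computable (jump B) (fun s => univ (pickle M2) (hd (s 0)) (tl (s 0))).
    by apply: comp_univ; comp.
  by rewrite /P; comp.
- move=> i; have [[d Ed]|nE] := pselect (exists d, E i d); last first.
    by exists 0; rewrite /P; apply/orP; left; apply/asboolPn.
  have [D2 _] := (HE _ _).1 Ed; have := H2 _ D2; rewrite pickle_decode.
  move=> /univP[u Hu]; exists (pc d u); rewrite /P hd_pc tl_pc Ed Hu.
  by rewrite orbT.
pose h i := (univ (pickle M2) (hd (t i)) (tl (t i))).-1.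
have Ch : computable (jump B) (fun s => h (s 0)).
  by apply: comp_pred; apply: comp_univ; comp.
have hP i d : E i d ->
    exists2 D, descriptors_of S2 (lang S1 (g i)) D & c2 D = h i.
  move=> Ed; have := Ht i; rewrite /P.
  have -> : `[< exists d, E i d >] by apply/asboolP; exists d.
  move=> /= /andP[/HE D2 Hu]; exists (CodeSeq.decode (hd (t i))) => //.
  apply: computes_fun (H2 _ (proj1 D2)) _; rewrite pickle_decode.
  by apply/univP; exists (tl (t i)); move: Hu; rewrite /h; case: univ.
(* The sum stands in for a maximum; arbitrary values of [h] at positions without equivalent only
   enlarge it. *)
pose sh n := nat_rec (fun=> nat) 0 (fun k r => r + h k) n.
have sh_ge i n : i < n -> h i <= sh n.
  elim: n => // n IH; rewrite ltnS leq_eqVlt => /orP[/eqP ->|/IH le] /=.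
    exact: leq_addl.
  exact: leq_trans le (leq_addr _ _).
have Csh : computable (jump B) (fun s => sh (s 0)).
  apply: (@comp_rec _ (fun=> 0) (fun s => s 0) (fun k r _ => r + h k)); comp.
exists (fun n => n + sh (N n)).
  split=> [n|D XD [D2 XD2 eqL]]; first by rewrite leq_addr.
  have := XD; rewrite -rg => -[j _ Ej]; subst D.
  have jN : j < N (c1 (g j)).
    by have [//|/mono le] := ltnP j; have := HN (c1 (g j)); lia.
  have Ej : E j (pickle D2) by apply/HE; rewrite decode_pickle.
  have [D HD ED] := hP _ _ Ej; exists D => //; rewrite ED.
  exact: leq_trans (sh_ge _ _ jN) (leq_addl _ _).
by apply: turing_computable; have C1 := comp_app1 (f := sh) Csh CN; comp.
Qed.

(** The case split on whether sizes are bounded is classical and not uniform: only the existence of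
    some suitable program for [f] matters. *)
Lemma bound_turing B S1 S2 c1 c2 A : complexity_measure S1 c1 ->
    complexity_measure S2 c2 ->
    (forall g : nat -> word, turing_le (fun i => pickle (g i)) set0 ->
      (forall i, descriptors S1 (g i)) ->
      exists2 E : nat -> nat -> bool, computable B (fun s => E (s 0) (s 1)) &
        forall i d, E i d <->
          descriptors_of S2 (lang S1 (g i)) (CodeSeq.decode d)) ->
  exists2 f, upper_bound A S1 S2 c1 c2 f & turing_le f (jump B).
Proof.
move=> hc1 hc2 HE; have [X0|[g [Tg rg mono]]] := cm_enum hc1 A.
  exists id; last by apply: turing_computable; comp.
  by split=> // D; rewrite X0.
have [unb|] := pselect (forall n, exists i, n < c1 (g i)).
  have [|E CE EE] := HE g Tg.
    move=> i; have [] : descriptors_over S1 A (g i) by rewrite -rg; exists i.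
    by [].
  exact: bound_unbounded CE EE.
move=> /existsNP[n0 Hn0].
have [|K HK] := @bound_bounded S1 S2 c1 c2 A n0 hc1.
  move=> D; rewrite -rg => -[i _ <-]; rewrite leqNgt; apply/negP => lt.
  by apply: Hn0; exists i.
by exists (fun n => n + K) => //; apply: turing_computable; comp.
Qed.

(** * Oracles that decide equivalence of descriptors *)

Lemma eq_mem_language (L1 L2 : language) :
  (forall w, (w \in L1) = (w \in L2)) -> L1 = L2.
Proof.
by move=> H; apply/seteqP; split=> w /mem_set; [rewrite H|rewrite -H] => /set_mem.
Qed.

(** A disagreement is witnessed by a word and a number of steps after which both deciders have
    answered differently. So inequivalence is r.e. and one jump decides it. *)
Lemma equiv_decide S1 S2 (g : nat -> word) :
    descriptional_system S1 -> descriptional_system S2 ->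
    recursive_system S1 -> recursive_system S2 ->
    turing_le (fun i => pickle (g i)) set0 -> (forall i, descriptors S1 (g i)) ->
  exists2 E : nat -> nat -> bool, computable (jump set0) (fun s => E (s 0) (s 1)) &
    forall i d, E i d <-> descriptors_of S2 (lang S1 (g i)) (CodeSeq.decode d).
Proof.
move=> hS1 hS2 r1 r2 [Mg Hg] Dg.
have Cg : computable set0 (fun s => pickle (g (s 0))).
  exact: (@comp_machine _ Mg id (fun i => pickle (g i)) (comp_var _ 0)).
have [P1 H1] := ds_decide hS1 r1; have [P2 H2] := ds_decide hS2 r2.
(* Here [n] pairs a number of steps with a word, and [x] pairs the index [i] with the code [d]; the
   value 0 means no answer yet. *)
pose v1 n x := eval (pickle P1) (pickle (g (hd x))) (tl n) (hd n).
pose v2 n x := eval (pickle P2) (tl x) (tl n) (hd n).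
pose T n x := [&& v1 n x != 0, v2 n x != 0 & v1 n x != v2 n x].
have CT : computable set0 (fun s => T (s 0) (s 1)).
  have C0 : computable set0 (fun s => pickle (g (hd (s 1)))).
    by apply: (comp_app1 (f := fun i => pickle (g i))) Cg _; comp.
  have C1 : computable set0 (fun s => v1 (s 0) (s 1)) by apply: comp_eval; comp.
  have C2 : computable set0 (fun s => v2 (s 0) (s 1)) by apply: comp_eval; comp.
  by rewrite /T; comp.
exists (fun i d => (CodeSeq.decode d \in descriptors S2) &&
  ~~ `[< exists n, T n (pc i d) >]).
  have Cd := comp_app1 (f := fun d => CodeSeq.decode d \in descriptors S2 : nat)
    (comp_decidable (jump set0) (ds_recursive hS2)) (comp_var _ 1).
  have Cx : computable (jump set0) (fun s => `[< exists n, T n (pc (s 0) (s 1)) >]).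
    by apply: comp_ex CT _; comp.
  by apply: comp_and Cd _; apply: comp_neg.
move=> i d; split.
  move=> /andP[]; rewrite in_setE => D2 /asboolPn nT; split=> //.
  have [M1 HM1 dM1] := H1 _ (Dg i); have [M2 HM2 dM2] := H2 _ D2.
  rewrite pickle_decode in HM2.
  apply: eq_mem_language => w.
  have [t1 E1] := (evalP _ _ HM1).1 (dM1 w).
  have [t2 E2] := (evalP _ _ HM2).1 (dM2 w).
  (* Both deciders have answered after the larger of the two numbers of steps. *)
  have {}E1 := eval_mono (leq_maxl t1 t2) E1.
  have {}E2 := eval_mono (leq_maxr t1 t2) E2.
  have : ~~ T (pc (maxn t1 t2) (pickle w)) (pc i d).
    by apply/negP => HT; apply: nT; exists (pc (maxn t1 t2) (pickle w)).
  rewrite /T /v1 /v2 !(hd_pc, tl_pc) E1 E2 /= negbK eqSS.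
  by case: (w \in lang S1 _); case: (w \in lang S2 _).
move=> [D2 eqL]; rewrite mem_set //=.
apply/asboolPn => -[n /and3P[n1 n2 /eqP]]; apply.
have [M1 HM1 dM1] := H1 _ (Dg i); have [M2 HM2 dM2] := H2 _ D2.
rewrite pickle_decode in HM2; move: n1 n2.
rewrite /v1 /v2 !(hd_pc, tl_pc).
case E1: eval => [|y1] // _; case E2: eval => [|y2] // _; congr _.+1.
have {E1} := (evalP (tl n) y1 HM1).2 (ex_intro _ _ E1).
have {E2} := (evalP (tl n) y2 HM2).2 (ex_intro _ _ E2).
rewrite -(pickle_decode (tl n)) => R2 R1.
by rewrite (computes_fun R1 (dM1 _)) (computes_fun R2 (dM2 _)) eqL.
Qed.

(** Membership is r.e., hence decidable in the first jump; searching for a word on which the two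
    memberships differ takes the second. *)
Lemma equiv_semidecide S1 S2 (g : nat -> word) :
    descriptional_system S1 -> descriptional_system S2 ->
    turing_le (fun i => pickle (g i)) set0 -> (forall i, descriptors S1 (g i)) ->
  exists2 E : nat -> nat -> bool,
    computable (jump (jump set0)) (fun s => E (s 0) (s 1)) &
    forall i d, E i d <-> descriptors_of S2 (lang S1 (g i)) (CodeSeq.decode d).
Proof.
move=> hS1 hS2 [Mg Hg] Dg.
have Cg : computable (jump set0) (fun s => pickle (g (s 0))).
  exact: (@comp_machine _ Mg id (fun i => pickle (g i)) (comp_var _ 0)).
have [P1 H1] := ds_semidecide hS1 (ds_re hS1).
have [P2 H2] := ds_semidecide hS2 (ds_re hS2).
pose K (P : machine) x := `[< exists t, eval (pickle P) (hd x) (tl x) t != 0 >].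
have CK (P : machine) a : computable (jump set0) a ->
      computable (jump set0) (fun s => K P (a s)).
  apply: (@comp_ex set0 (fun t x => eval (pickle P) (hd x) (tl x) t != 0)).
  by apply: comp_neg; apply: comp_eq; [apply: comp_eval|]; comp.
have KP P M D L w : computes set0 P D (pickle M) -> semidecides M L ->
    K P (pc D (pickle w)) <-> L w.
  move=> HP dM; rewrite -dM; split=> [/asboolP[t]|[y /(evalP _ _ HP)[t Et]]].
    rewrite hd_pc tl_pc; case Et: eval => [|y] // _.
    by exists y; apply/(evalP _ _ HP); exists t.
  by apply/asboolP; exists t; rewrite hd_pc tl_pc Et.
(* Every number [w] is the code of a word, so the search need not restrict it. *)
pose T w x := (K P1 (pc (pickle (g (hd x))) w) : nat) != K P2 (pc (tl x) w).
have CT : computable (jump set0) (fun s => T (s 0) (s 1)).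
  have C0 : computable (jump set0) (fun s => pickle (g (hd (s 1)))).
    by apply: (comp_app1 (f := fun i => pickle (g i))) Cg _; comp.
  by apply: comp_neg; apply: comp_eq; apply: CK; comp.
exists (fun i d => (CodeSeq.decode d \in descriptors S2) &&
  ~~ `[< exists n, T n (pc i d) >]).
  have Cd := comp_app1 (f := fun d => CodeSeq.decode d \in descriptors S2 : nat)
    (comp_decidable (jump (jump set0)) (ds_recursive hS2)) (comp_var _ 1).
  have Cx : computable (jump (jump set0))
      (fun s => `[< exists n, T n (pc (s 0) (s 1)) >]).
    by apply: comp_ex CT _; comp.
  by apply: comp_and Cd _; apply: comp_neg.
move=> i d; have [M1 HM1 dM1] := H1 _ (Dg i); split.
  move=> /andP[]; rewrite in_setE => D2 /asboolPn nT; split=> //.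
  have [M2 HM2 dM2] := H2 _ D2; rewrite pickle_decode in HM2.
  apply/funext => w; apply/propext.
  have : ~~ T (pickle w) (pc i d) by apply/negP => HT; apply: nT; exists (pickle w).
  rewrite /T !(hd_pc, tl_pc) negbK -(KP _ _ _ _ w HM1 dM1) -(KP _ _ _ _ w HM2 dM2).
  by case: (K P1 _); case: (K P2 _).
move=> [D2 eqL]; rewrite mem_set //=; apply/asboolPn => -[n].
have [M2 HM2 dM2] := H2 _ D2; rewrite pickle_decode in HM2.
rewrite /T !(hd_pc, tl_pc) -(pickle_decode n) => /eqP; apply; congr nat_of_bool.
apply/idP/idP => [/(KP _ _ _ _ _ HM1 dM1)|/(KP _ _ _ _ _ HM2 dM2)] H.
  by apply/(KP _ _ _ _ _ HM2 dM2); rewrite eqL.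
by apply/(KP _ _ _ _ _ HM1 dM1); rewrite -eqL.
Qed.

Theorem theorem2 (S1 S2 : system) (c1 c2 : word -> nat) (A : alphabet)
  (hS1 : descriptional_system S1) (hS2 : descriptional_system S2)
  (hc1 : complexity_measure S1 c1) (hc2 : complexity_measure S2 c2)
  (hne : languages S1 `&` languages S2 !=set0) :
  (recursive_system S1 /\ recursive_system S2 ->
     exists2 f : nat -> nat, upper_bound A S1 S2 c1 c2 f
                           & turing_le f (iter 2 jump set0)) /\
  (~ recursive_system S1 \/ ~ recursive_system S2 ->
     exists2 f : nat -> nat, upper_bound A S1 S2 c1 c2 f
                           & turing_le f (iter 3 jump set0)).
Proof.
split=> [[r1 r2]|_].
  (* One jump decides equivalence, and the bound adds one more. *)
  apply: (@bound_turing (jump set0)) => // g Tg Dg.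
  exact: equiv_decide hS1 hS2 r1 r2 Tg Dg.
apply: (@bound_turing (jump (jump set0))) => // g Tg Dg.
exact: equiv_semidecide hS1 hS2 Tg Dg.
Qed.
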